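(* Let $\operatorname{vec}(F(\mathbf{x})) \sim \mathcal{GP}\big(\operatorname{vec}(\mathbf{M}_0(\mathbf{x})),\, \mathbf{B}_0(\mathbf{x},\mathbf{x}')\otimes \mathbf{A}\big)$ be the prior on the matrix-valued function $F(\mathbf{x})\in\mathbb{R}^{n\times(1+m)}$, with $\mathbf{B}_0(\mathbf{x},\mathbf{x}')\in\mathbb{R}^{(m+1)\times(m+1)}$ and $\mathbf{A}\in\mathbb{R}^{n\times n}$. Let the training data be noiseless states $\mathbf{X}_{1:k}=[\mathbf{x}_1,\dots,\mathbf{x}_k]$ and controls $\mathbf{U}_{1:k}=[\mathbf{u}_1,\dots,\mathbf{u}_k]$, and noisy derivatives $\dot{\mathbf{X}}_{1:k}=[\dot{\mathbf{x}}_1,\dots,\dot{\mathbf{x}}_k]$ with $\dot{\mathbf{x}}_i=F(\mathbf{x}_i)\underline{\mathbf{u}}_i+\mathbf{w}_i$, where the $\mathbf{w}_i\sim\mathcal{N}(\mathbf{0},\sigma^2\mathbf{A})$ are mutually independent and independent of $F$, and $\sigma>0$. Then the posterior distribution of $\operatorname{vec}(F(\mathbf{x}))$ conditioned on $(\mathbf{X}_{1:k},\mathbf{U}_{1:k},\dot{\mathbf{X}}_{1:k})$ is the Gaussian process $\mathcal{GP}\big(\operatorname{vec}(\mathbf{M}_k(\mathbf{x})),\,\mathbf{B}_k(\mathbf{x},\mathbf{x}')\otimes\mathbf{A}\big)$ with $$\mathbf{M}_k(\mathbf{x}) = \mathbf{M}_0(\mathbf{x}) + \big(\dot{\mathbf{X}}_{1:k}-\boldsymbol{\mathcal{M}}_{1:k}\underline{\boldsymbol{\mathcal{U}}}_{1:k}\big)\,\mathbf{D}_k(\mathbf{x}),$$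 $$\mathbf{B}_k(\mathbf{x},\mathbf{x}') = \mathbf{B}_0(\mathbf{x},\mathbf{x}') - \boldsymbol{\mathcal{B}}_{1:k}(\mathbf{x})\,\underline{\boldsymbol{\mathcal{U}}}_{1:k}\,\mathbf{D}_k(\mathbf{x}'),$$ where $$\mathbf{D}_k(\mathbf{x}) = \big(\underline{\boldsymbol{\mathcal{U}}}_{1:k}^\top \boldsymbol{\mathcal{B}}_{1:k}^{1:k}\,\underline{\boldsymbol{\mathcal{U}}}_{1:k}+\sigma^2\mathbf{I}_k\big)^{-1}\underline{\boldsymbol{\mathcal{U}}}_{1:k}^\top\,\boldsymbol{\mathcal{B}}_{1:k}(\mathbf{x})^\top .$$
   Context: $\operatorname{vec}$ stacks the columns of a matrix; $\otimes$ is the Kronecker product. For $\mathbf{u}\in\mathbb{R}^m$, $\underline{\mathbf{u}}=[1,\mathbf{u}^\top]^\top\in\mathbb{R}^{1+m}$. $\mathbf{A}$ is symmetric positive definite and $(\mathbf{x},\mathbf{x}')\mapsto\mathbf{B}_0(\mathbf{x},\mathbf{x}')$ is a matrix-valued positive semidefinite kernel (in particular $\mathbf{B}_0(\mathbf{x},\mathbf{x}')^\top=\mathbf{B}_0(\mathbf{x}',\mathbf{x})$); ''$\operatorname{vec}(F)\sim\mathcal{GP}(\mu,\mathbf{K})$'' means that finite-dimensional marginals are jointly Gaussian with mean $\mu(\mathbf{x})$ and cross-covariance $\mathbf{K}(\mathbf{x},\mathbf{x}')$. Notation: $\boldsymbol{\mathcal{B}}_{1:k}^{1:k}\in\mathbb{R}^{k(m+1)\times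 k(m+1)}$ is the block matrix with $(i,j)$ block $\mathbf{B}_0(\mathbf{x}_i,\mathbf{x}_j)$; $\boldsymbol{\mathcal{M}}_{1:k}=[\mathbf{M}_0(\mathbf{x}_1)\ \cdots\ \mathbf{M}_0(\mathbf{x}_k)]\in\mathbb{R}^{n\times k(m+1)}$; $\boldsymbol{\mathcal{B}}_{1:k}(\mathbf{x})=[\mathbf{B}_0(\mathbf{x},\mathbf{x}_1),\dots,\mathbf{B}_0(\mathbf{x},\mathbf{x}_k)]\in\mathbb{R}^{(m+1)\times k(m+1)}$; $\underline{\boldsymbol{\mathcal{U}}}_{1:k}=\operatorname{diag}(\underline{\mathbf{u}}_1,\dots,\underline{\mathbf{u}}_k)\in\mathbb{R}^{k(m+1)\times k}$ is block diagonal. The states and controls are treated as given (deterministic) values. *)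

(* Defs.v *)
From HB Require Import structures.
From mathcomp Require Export all_boot all_order all_algebra.
From mathcomp Require Export all_classical all_reals all_analysis.
From mathcomp Require Export measurable_realfun mxtens.
Export Order.TTheory GRing.Theory Num.Theory.
Export numFieldNormedType.Exports.

Set Implicit Arguments.
Unset Strict Implicit.
Unset Printing Implicit Defensive.

Local Open Scope classical_set_scope.
Local Open Scope ring_scope.

(* Matrices carry the sigma-algebra generated by their entries (the Borel one
   when the entries are real). *)

Definition measure_matrix_display : measure_display -> measure_display.
Proof. exact. Qed.

Section measurable_matrix.
Context {d : measure_display} {E : measurableType d} (m n : nat).

Definition matrix_measurable : set (set 'M[E]_(m, n)) :=
  <<s \bigcup_(ij in [set: 'I_m * 'I_n])
        preimage_set_system setT (fun M : 'M[E]_(m, n) => M ij.1 ij.2)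
          measurable >>.

Let matrix_set0 : matrix_measurable set0.
Proof. exact: sigma_algebra0. Qed.

Let matrix_setC (A : set 'M[E]_(m, n)) :
  matrix_measurable A -> matrix_measurable (~` A).
Proof. exact: sigma_algebraC. Qed.

Let matrix_bigcup (A : (set 'M[E]_(m, n))^nat) :
  (forall i, matrix_measurable (A i)) -> matrix_measurable (\bigcup_i A i).
Proof. exact: sigma_algebra_bigcup. Qed.

HB.instance Definition _ := @isMeasurable.Build (measure_matrix_display d)
  'M[E]_(m, n) matrix_measurable matrix_set0 matrix_setC matrix_bigcup.

End measurable_matrix.

(* All functions S -> E, with the product sigma-algebra. *)

Definition cylinders (S : Type) d (E : measurableType d) : set (set (S -> E)) :=
  \bigcup_(s in [set: S])
    preimage_set_system setT (fun f : S -> E => f s) measurable.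

Definition path_space (S : Type) d (E : measurableType d) :=
  g_sigma_algebraType (@cylinders S d E).

Definition sample_path (S T : Type) d (E : measurableType d) (X : S -> T -> E) :
  T -> path_space S E := fun w s => X s w.

Section gaussian.
Context d (T : measurableType d) (R : realType) (P : probability T R).

(* The univariate N(m, s^2), degenerate when s = 0: the library's normal_prob
   m 0 is not the Dirac mass at m but the uniform law on [0, 1]. *)
Definition gaussian_law (m s : R) (A : set R) : \bar R :=
  if s == 0 then \d_m A else normal_prob m s A.

Definition jointly_gaussian (I : finType) (X : I -> T -> R) : Prop :=
  (forall i, measurable_fun setT (X i)) /\
  forall c : I -> R, exists m s : R, 0 <= s /\
    forall A : set R, measurable A ->
      P ((fun w => \sum_i c i * X i w) @^-1` A) = gaussian_law m s A.

Definition gaussian_family (I : finType) (X : I -> T -> R)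
    (mu : I -> R) (Sigma : I -> I -> R) : Prop :=
  [/\ jointly_gaussian X,
      forall i, ('E_P[X i])%E = (mu i)%:E &
      forall i j, covariance P (X i) (X j) = (Sigma i j)%:E].

Definition gaussian_vector (N : nat) (X : T -> 'cV[R]_N)
    (mu : 'cV[R]_N) (Sigma : 'M[R]_N) : Prop :=
  gaussian_family (fun i w => X w i 0) (fun i => mu i 0) (fun i j => Sigma i j).

(* The marginal at x_1, ..., x_p is indexed by pairs (a, r), standing for the
   r-th component at the point x_a; repeated points are allowed. *)
Definition gaussian_process (S : Type) (N : nat) (X : S -> T -> 'cV[R]_N)
    (mu : S -> 'cV[R]_N) (K : S -> S -> 'M[R]_N) : Prop :=
  forall (p : nat) (x : 'I_p -> S),
    @gaussian_family ('I_p * 'I_N)%type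
      (fun i w => X (x i.1) w i.2 0)
      (fun i => mu (x i.1) i.2 0)
      (fun i j => K (x i.1) (x j.1) i.2 j.2).

End gaussian.

Section independence_and_conditioning.
Context d (T : measurableType d) (R : realType) (P : probability T R).

Definition independent d1 d2 (E1 : measurableType d1) (E2 : measurableType d2)
    (X : T -> E1) (Y : T -> E2) : Prop :=
  forall A B, measurable A -> measurable B ->
    P (X @^-1` A `&` Y @^-1` B) = (P (X @^-1` A) * P (Y @^-1` B))%E.

Definition mutually_independent (I : finType) d' (E : measurableType d')
    (X : I -> T -> E) : Prop :=
  forall (J : {set I}) (A : I -> set E), (forall i, measurable (A i)) ->
    P (\bigcap_(i in [set` J]) (X i @^-1` A i)) =
    (\prod_(i in J) P (X i @^-1` A i))%E.

(* kappa is a regular conditional distribution of Z given Y. *)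
Definition conditional_distribution d1 d2 (E1 : measurableType d1)
    (E2 : measurableType d2) (Z : T -> E1) (Y : T -> E2)
    (kappa : E2 -> probability E1 R) : Prop :=
  (forall C, measurable C -> measurable_fun setT (kappa ^~ C)) /\
  forall C D, measurable C -> measurable D ->
    P (Z @^-1` C `&` Y @^-1` D) = (\int[P]_(w in Y @^-1` D) kappa (Y w) C)%E.

End independence_and_conditioning.

Section matrices.
Context {R : realType}.

(* mxtens_unindex k = (k %/ m, k %% m): columns are stacked, in the indexing
   convention of the Kronecker product *t. *)
Definition vec (m n : nat) (M : 'M[R]_(m, n)) : 'cV[R]_(n * m) :=
  \col_k M (mxtens_unindex k).2 (mxtens_unindex k).1.

Definition posdef_mx (n : nat) (A : 'M[R]_n) : Prop :=
  A^T = A /\ forall v : 'cV[R]_n, v != 0 -> 0 < (v^T *m A *m v) 0 0.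

Definition psd_kernel (S : Type) (q : nat) (B : S -> S -> 'M[R]_q) : Prop :=
  (forall x x', (B x x')^T = B x' x) /\
  forall (p : nat) (x : 'I_p -> S) (c : 'I_p -> 'cV[R]_q),
    0 <= (\sum_i \sum_j (c i)^T *m B (x i) (x j) *m c j) 0 0.

Definition underline (m : nat) (u : 'cV[R]_m) : 'cV[R]_(1 + m) :=
  col_mx (1%:M : 'cV[R]_1) u.

End matrices.

Section posterior.
Context {R : realType} {n m k : nat}.
Variables (M0 : 'cV[R]_n -> 'M[R]_(n, 1 + m))
          (B0 : 'cV[R]_n -> 'cV[R]_n -> 'M[R]_(1 + m)).
Variables (sigma : R) (xs : 'I_k -> 'cV[R]_n) (us : 'I_k -> 'cV[R]_m).

Definition calM : 'M[R]_(n, \sum_(i < k) (1 + m)) := \mxrow_(i < k) M0 (xs i).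

Definition calB : 'M[R]_(\sum_(i < k) (1 + m)) :=
  \mxblock_(i < k, j < k) B0 (xs i) (xs j).

Definition calBx (x : 'cV[R]_n) : 'M[R]_(1 + m, \sum_(i < k) (1 + m)) :=
  \mxrow_(i < k) B0 x (xs i).

(* Block diagonal with the columns underline (us i) as blocks; \mxdiag only
   handles square blocks. *)
Definition calU : 'M[R]_(\sum_(i < k) (1 + m), k) :=
  \mxcol_(i < k) \matrix_(r < 1 + m, j < k)
    (if i == j then underline (us i) r 0 else 0).

Definition Dk (x : 'cV[R]_n) : 'M[R]_(k, 1 + m) :=
  invmx (calU^T *m calB *m calU + (sigma ^+ 2)%:M) *m calU^T *m (calBx x)^T.

Definition Mk (dX : 'M[R]_(n, k)) (x : 'cV[R]_n) : 'M[R]_(n, 1 + m) :=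
  M0 x + (dX - calM *m calU) *m Dk x.

Definition Bk (x x' : 'cV[R]_n) : 'M[R]_(1 + m) :=
  B0 x x' - calBx x *m calU *m Dk x'.

End posterior.

(* Main.v *)
From HB Require Import structures.
Require Import Defs.
From mathcomp Require Import ring lra.

Set Implicit Arguments.
Unset Strict Implicit.
Unset Printing Implicit Defensive.

Local Open Scope classical_set_scope.
Local Open Scope ring_scope.

(** Matheron's rule. The residual path [x |-> F x - dX *m Dk x] is uncorrelated
    with the observations [dX], hence independent of them, so that the
    conditional law of [F] given [dX = y] is the law of the residual path shifted
    by [y *m Dk x]; its mean and covariance are then linear algebra.

    That uncorrelated elements [f], [g] of a space of Gaussian variables are
    independent is proved without computing a characteristic function: [f + g]
    and [f - g] have the same laws as the sum and difference of independent copies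
    of [f] and [g], because Gaussian laws are stable under convolution and
    determined by mean and variance, so [cos f * cos g] has the expected
    expectation; a functional monotone class argument passes from cosines to all
    measurable sets. *)

(** * Affine images and convolutions of normal laws *)

(** Two obstacles shape the proof. The conditioned object is a whole path over an index set that is
    in general uncountable. The kernel is therefore written down explicitly, as the law of a shifted
    path, and independence is proved for sigma-algebras with respect to which a path is measurable
    as soon as each of its entries is. Moreover the Gaussianity of the signal and of each noise
    vector is given separately, with unspecified parameters for their linear combinations. The joint
    Gaussian space has to be assembled from independence, whence the convolution of normal laws,
    degenerate ones included; the parameters are then recovered from moments. The coefficients [Dk]
    do not involve [A]: the noise covariance is proportional to [A], so an entry of [A] is a common
    factor of the covariance of [F] with [dX] and of that of [dX] with itself. Regression thus acts
    on the [k] inputs alone and preserves the Kronecker form. *)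

Definition affine {R : pzRingType} (a b x : R) : R := a * x + b.

Section normal_affine.
Context {R : realType}.
Notation mu := (@lebesgue_measure R).

Lemma measurable_affine (a b : R) : measurable_fun setT (affine a b).
Proof. by apply: measurable_funD => //; exact: measurable_funM. Qed.

Lemma affine_preimage_itv_oc (a b c d : R) : 0 < a ->
  affine a b @^-1` `]c, d] = `](c - b) / a, (d - b) / a]%classic.
Proof.
move=> a0; apply/seteqP; split=> x /=; rewrite /affine !in_itv/=;
by rewrite ltr_pdivrMr// ler_pdivlMr// ltrBlDr lerBrDr mulrC.
Qed.

Lemma affine_preimage_itv_oc_neg (a b c d : R) : a < 0 ->
  affine a b @^-1` `]c, d] = `[(d - b) / a, (c - b) / a[%classic.
Proof.
move=> a0; apply/seteqP; split=> x /=; rewrite /affine !in_itv/=;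
by rewrite ler_ndivrMr// ltr_ndivlMr// ltrBlDr lerBrDr mulrC andbC.
Qed.

(** By uniqueness of Lebesgue measure: [|a|] times its image under the map gives every half-open
    interval its length. For [a < 0] the preimage is closed at the other end, which does not change
    its measure. *)
Lemma lebesgue_measure_affine (a b : R) (A : set R) : a != 0 -> measurable A ->
  mu (affine a b @^-1` A) = (`|a|^-1%:E * mu A)%E.
Proof.
move=> a0 mA.
have mf : measurable_fun [set: measurableTypeR R]
    (affine a b : measurableTypeR R -> measurableTypeR R).
  exact: measurable_affine.
pose f : {mfun measurableTypeR R >-> measurableTypeR R} := HB.pack
  (affine a b : measurableTypeR R -> measurableTypeR R)
  (isMeasurableFun.Build _ _ _ _ _ mf).
pose ra := NngNum (normr_ge0 a).
suff -> : mu A = (`|a|%:E * mu (affine a b @^-1` A))%E.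
  by rewrite muleA -EFinM mulVf ?normr_eq0// mul1e.
apply: (@lebesgue_measure_unique R (mscale ra (pushforward mu f))) => //.
move=> _ [[c d] _ <-] /=.
rewrite /mscale/= /pushforward/=.
have [a_lt0|a_gt0|] := ltgtP a 0; last by move/eqP: a0.
- rewrite affine_preimage_itv_oc_neg// !lebesgue_measure_itv/= !lte_fin.
  rewrite ltr_ndivrMr// divfK ?lt_eqF// ltrD2r.
  case: ifPn => _; last by rewrite mule0.
  rewrite -!EFinB -EFinM ltr0_norm//; congr _%:E.
  by field.
- rewrite affine_preimage_itv_oc// !lebesgue_measure_itv/= !lte_fin.
  rewrite ltr_pdivrMr// divfK ?gt_eqF// ltrD2r.
  case: ifPn => _; last by rewrite mule0.
  rewrite -!EFinB -EFinM gtr0_norm//; congr _%:E.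
  by field.
Qed.

Lemma ge0_integral_affine (a b : R) (A : set R) (g : R -> \bar R) :
  a != 0 -> measurable A -> measurable_fun setT g -> (forall x, 0 <= g x)%E ->
  (\int[mu]_(x in affine a b @^-1` A) g (affine a b x)
   = `|a|^-1%:E * \int[mu]_(x in A) g x)%E.
Proof.
move=> a0 mA mg g0.
have mf : measurable_fun [set: measurableTypeR R]
    (affine a b : measurableTypeR R -> measurableTypeR R).
  exact: measurable_affine.
have mgA : measurable_fun (A : set (measurableTypeR R)) g.
  exact: (measurable_funS measurableT (@subsetT _ A) mg).
have ra0 : 0 <= `|a|^-1 by rewrite invr_ge0.
pose ra := NngNum ra0.
rewrite -[LHS](@ge0_integral_pushforward _ _ (measurableTypeR R)
  (measurableTypeR R) R _ mf mu A g)//.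
transitivity (\int[mscale ra mu]_(x in A) g x)%E; last first.
  by rewrite ge0_integral_mscale.
by apply: eq_measure_integral => B mB _; exact: lebesgue_measure_affine.
Qed.

Lemma normal_pdf_affine (a b m s x : R) : a != 0 -> s != 0 ->
  normal_pdf m s x = `|a| * normal_pdf (affine a b m) (`|a| * s) (affine a b x).
Proof.
move=> a0 s0; rewrite !normal_pdfE// ?mulf_neq0 ?normr_eq0//.
rewrite mulrA; congr (_ * _).
  rewrite /normal_peak -[RHS]invf_div.
  have -> : (`|a| * s) ^+ 2 * pi *+ 2 = a ^+ 2 * (s ^+ 2 * pi *+ 2).
    by rewrite exprMn real_normK ?num_real// -mulrA -mulrnAr.
  by rewrite sqrtrM ?sqr_ge0// sqrtr_sqr [_ * _ / `|a|]mulrAC mulfV ?mul1r// normr_eq0.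
rewrite /normal_fun /affine; congr expR.
rewrite exprMn real_normK ?num_real//.
by field; rewrite a0 s0.
Qed.

Lemma normal_prob_affine (a b m s : R) (A : set R) :
  a != 0 -> s != 0 -> measurable A ->
  normal_prob m s (affine a b @^-1` A)
  = normal_prob (affine a b m) (`|a| * s) A.
Proof.
move=> a0 s0 mA; rewrite /normal_prob.
pose g z : \bar R := (normal_pdf (affine a b m) (`|a| * s) z)%:E.
have mg : measurable_fun setT g.
  by apply/measurable_EFinP; exact: measurable_normal_pdf.
have g0 z : (0 <= g z)%E by rewrite lee_fin normal_pdf_ge0.
have mfA : measurable (affine a b @^-1` A).
  by rewrite -[X in measurable X]setTI; exact: measurable_affine.
have mgf : measurable_fun (affine a b @^-1` A) (g \o affine a b).
  by apply/measurable_funTS/measurableT_comp => //; exact: measurable_affine.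
under eq_integral do rewrite (normal_pdf_affine b m _ a0 s0) EFinM.
rewrite (@ge0_integralZl _ _ _ mu _ mfA (g \o affine a b))//=.
by rewrite ge0_integral_affine// muleA -EFinM mulfV ?normr_eq0// mul1e.
Qed.

Lemma gaussian_law_affine (a b m s : R) (A : set R) : a != 0 -> measurable A ->
  gaussian_law m s (affine a b @^-1` A)
  = gaussian_law (affine a b m) (`|a| * s) A.
Proof.
move=> a0 mA; rewrite /gaussian_law mulf_eq0 normr_eq0 (negbTE a0)/=.
have [//|s0] := eqVneq s 0; exact: normal_prob_affine.
Qed.

End normal_affine.

Section normal_convolution.
Context {R : realType}.
Notation mu := (@lebesgue_measure R).

(** The Radon-Nikodym derivative of [normal_prob] agrees almost everywhere with [normal_pdf], since
    both have the same integral over every measurable set. *)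
Lemma integral_normal_prob (m s : R) (f : R -> \bar R) :
  (normal_prob m s).-integrable setT f ->
  (\int[normal_prob m s]_x f x = \int[mu]_x (f x * (normal_pdf m s x)%:E))%E.
Proof.
move=> intf.
have mf : measurable_fun [set: R] f by exact: measurable_int intf.
rewrite -(Radon_Nikodym_change_of_variables (normal_prob_dominates m s))//=.
apply: ae_eq_integral => //.
- apply: emeasurable_funM => //; apply: (measurable_int mu).
  by apply: Radon_Nikodym_integrable; exact: normal_prob_dominates.
- apply: emeasurable_funM => //=; apply/measurable_EFinP.
  exact: measurable_normal_pdf.
- apply: ae_eqe_mul2l => /=.
  rewrite Radon_NikodymE//=; first exact: normal_prob_dominates.
  move=> abmu; case: cid => /= h [h1 h2 h3].
  apply: integral_ae_eq => //=.
  + by apply/measurable_EFinP; exact: measurable_normal_pdf.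
  + by move=> E E01 mE; rewrite -h3.
Qed.

(** Completing the square in [x]. Read as Bayes' rule: prior times likelihood is the density of the
    sum at [z] times the conditional density of the first summand. *)
Lemma normal_pdf_mul (m1 s1 m2 s2 x z : R) : 0 < s1 -> 0 < s2 ->
  let r := Num.sqrt (s1 ^+ 2 + s2 ^+ 2) in
  normal_pdf m1 s1 x * normal_pdf (affine 1 x m2) s2 z =
  normal_pdf (m1 + m2) r z *
  normal_pdf ((s2 ^+ 2 * m1 + s1 ^+ 2 * (z - m2)) / r ^+ 2) (s1 * s2 / r) x.
Proof.
move=> s1_gt0 s2_gt0 r.
have r2 : r ^+ 2 = s1 ^+ 2 + s2 ^+ 2.
  by rewrite sqr_sqrtr// addr_ge0 ?sqr_ge0.
have r2_gt0 : 0 < r ^+ 2 by rewrite r2 addr_gt0 ?exprn_gt0.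
have r0 : r != 0 by rewrite -sqrf_eq0 gt_eqF.
rewrite !normal_pdfE ?mulf_neq0 ?invr_neq0// ?gt_eqF//.
rewrite mulrACA [RHS]mulrACA; congr (_ * _).
  rewrite /normal_peak -!invfM; congr (_^-1).
  rewrite -!sqrtrM ?mulrn_wge0 ?mulr_ge0 ?sqr_ge0 ?pi_ge0 ?invr_ge0 ?sqrtr_ge0
    ?(ltW s1_gt0) ?(ltW s2_gt0)//.
  by congr Num.sqrt; field.
rewrite /normal_fun -!expRD; congr expR.
rewrite !expr_div_n !exprMn r2 /affine.
rewrite r2 in r2_gt0.
field; rewrite !gt_eqF//.
Qed.

(* [normal_prob] lives on [measurableTypeR R]; this moves it to [R], whose
   display differs. *)
Lemma measurable_measurableTypeR :
  measurable_fun [set: measurableTypeR R] (idfun : measurableTypeR R -> R).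
Proof. exact: measurable_id. Qed.

Definition normal_law (m s : R) : probability R R :=
  distribution (normal_prob m s)
    (HB.pack_for {mfun measurableTypeR R >-> R} (idfun : measurableTypeR R -> R)
      (isMeasurableFun.Build _ _ _ _ _ measurable_measurableTypeR)).

Lemma measurable_translation (Q : probability R R) (A : set R) : measurable A ->
  measurable_fun [set: R] (fun x : R => Q (affine 1 x @^-1` A)).
Proof.
move=> mA; pose S : set (R * R) := (fun p => p.1 + p.2) @^-1` A.
have mS : measurable S by rewrite -[S]setTI; apply: measurable_funD.
have := measurable_fun_xsection Q mS.
congr measurable_fun; apply/funext => x /=; congr (Q _).
by apply/seteqP; split=> y; rewrite /xsection/= inE /S/= /affine mul1r addrC.
Qed.

(** Tonelli exchanges the integrals; after [normal_pdf_mul] the inner one is that of a probability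
    density in [x]. *)
Lemma normal_prob_conv (m1 s1 m2 s2 : R) (A : set R) : 0 < s1 -> 0 < s2 ->
  measurable A ->
  (\int[normal_prob m1 s1]_x normal_prob m2 s2 (affine 1 x @^-1` A)
   = normal_prob (m1 + m2) (Num.sqrt (s1 ^+ 2 + s2 ^+ 2)) A)%E.
Proof.
move=> s1_gt0 s2_gt0 mA; set r := Num.sqrt _.
have s10 : s1 != 0 by rewrite gt_eqF.
have s20 : s2 != 0 by rewrite gt_eqF.
pose h (p : R * R) := normal_pdf (affine 1 p.1 m2) s2 p.2.
have h0 p : 0 <= h p by exact: normal_pdf_ge0.
have mh : measurable_fun setT h.
  (* [normal_pdf] is measurable in its argument for a fixed mean; centring at 0 moves the varying
     mean into the argument. *)
  rewrite (_ : h = normal_pdf 0 s2 \o (fun p => p.2 - (p.1 + m2))).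
    apply: measurableT_comp; first exact: measurable_normal_pdf.
    by apply: measurable_funB => //; exact: measurable_funD.
  apply/funext => p /=.
  have /= -> := normal_pdf_affine (p.1 + m2) 0 (p.2 - (p.1 + m2)) (oner_neq0 R) s20.
  by rewrite normr1 !mul1r /h /affine !mul1r add0r subrK (addrC m2).
have mk : measurable_fun [set: R]
    (fun x : R => normal_prob m2 s2 (affine 1 x @^-1` A)).
  exact: (measurable_translation (normal_law m2 s2) mA).
have E x : (normal_prob m2 s2 (affine 1 x @^-1` A)
            = \int[mu]_(z in A) (h (x, z))%:E)%E.
  rewrite (normal_prob_affine x m2 (oner_neq0 R) s20 mA) normr1 mul1r.
  by rewrite /normal_prob.
rewrite integral_normal_prob; last first.
  apply: (@le_integrable _ _ _ _ _ _ _ (cst 1%E)) => //.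
  - move=> x _ /=; rewrite gee0_abs// normr1.
    apply: probability_le1; rewrite -[X in measurable X]setTI.
    exact: measurable_affine.
  - exact: finite_measure_integrable_cst.
pose F p := ((h p)%:E * (\1_A p.2)%:E * (normal_pdf m1 s1 p.1)%:E)%E.
have F0 p : (0 <= F p)%E.
  by rewrite /F -!EFinM lee_fin !mulr_ge0// normal_pdf_ge0.
have mF : measurable_fun setT F.
  apply/measurable_EFinP; apply: measurable_funM.
    apply: measurable_funM => //.
    by apply: measurableT_comp; [exact: measurable_indic|].
  by apply: measurableT_comp => //; exact: measurable_normal_pdf.
transitivity (\int[mu]_x \int[mu]_z F (x, z))%E.
  apply: eq_integral => x _; rewrite E /F/= integral_mkcond.
  rewrite -ge0_integralZr ?lee_fin ?normal_pdf_ge0//.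
  - apply: eq_integral => z _; rewrite patchE indicE.
    by case: ifPn => _; rewrite ?mule1 ?mule0.
  - apply/measurable_restrict => //; rewrite setTI; apply/measurable_EFinP.
    by apply/measurable_funTS; apply: measurableT_comp mh _.
  - by move=> z _; rewrite patchE; case: ifPn => // _; rewrite lee_fin.
rewrite fubini_tonelli//.
rewrite /normal_prob [RHS]integral_mkcond; apply: eq_integral => z _.
rewrite /F/= patchE indicE; case: ifPn => _; last first.
  by apply: integral0_eq => x _; rewrite mule0 mul0e.
transitivity (\int[mu]_x ((normal_pdf (m1 + m2) r z)%:E * (normal_pdf
  ((s2 ^+ 2 * m1 + s1 ^+ 2 * (z - m2)) / r ^+ 2) (s1 * s2 / r) x)%:E))%E.
  by apply: eq_integral => x _; rewrite mule1 -!EFinM mulrC normal_pdf_mul.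
rewrite ge0_integralZl//.
- by rewrite integral_normal_pdf mule1.
- by apply/measurable_EFinP; exact: measurable_normal_pdf.
- by move=> x _; rewrite lee_fin normal_pdf_ge0.
- by rewrite lee_fin normal_pdf_ge0.
Qed.

Definition gaussian_prob (m s : R) : probability R R :=
  if s == 0 then (\d_m : probability R R) else normal_law m s.

Lemma gaussian_probE (m s : R) (A : set R) :
  gaussian_prob m s A = gaussian_law m s A.
Proof. by rewrite /gaussian_prob /gaussian_law; case: ifP. Qed.

(** Convolution with a Dirac mass is a translation, covered by [gaussian_law_affine]; densities
    handle the case of two positive deviations. *)
Lemma gaussian_prob_conv (m1 s1 m2 s2 : R) (A : set R) : 0 <= s1 -> 0 <= s2 ->
  measurable A ->
  (\int[gaussian_prob m1 s1]_x gaussian_prob m2 s2 (affine 1 x @^-1` A)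
   = gaussian_prob (m1 + m2) (Num.sqrt (s1 ^+ 2 + s2 ^+ 2)) A)%E.
Proof.
move=> s1_ge0 s2_ge0 mA.
have mpre x : measurable (affine 1 x @^-1` A).
  by rewrite -[X in measurable X]setTI; exact: measurable_affine.
have [->|s20] := eqVneq s2 0.
  rewrite expr0n/= addr0 sqrtr_sqr ger0_norm// {2}/gaussian_prob eqxx/=.
  under eq_integral do rewrite diracE.
  rewrite (eq_integral (EFin \o \1_(affine 1 m2 @^-1` A))); last first.
    move=> x _; rewrite /= indicE; congr (nat_of_bool _)%:R%:E.
    by apply/idP/idP; rewrite !inE/= /affine !mul1r addrC.
  rewrite integral_indic// setIT gaussian_probE.
  transitivity (gaussian_law m1 s1 (affine 1 m2 @^-1` A)).
    exact: gaussian_probE.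
  rewrite (gaussian_law_affine _ _ _ (oner_neq0 R) mA).
  by rewrite normr1 /affine !mul1r.
have [->|s10] := eqVneq s1 0.
  rewrite expr0n/= add0r sqrtr_sqr ger0_norm// {1}/gaussian_prob eqxx/=.
  rewrite integral_dirac//=; last first.
    exact: measurable_translation.
  rewrite diracT mul1e !gaussian_probE.
  rewrite (gaussian_law_affine _ _ _ (oner_neq0 R) mA).
  by rewrite normr1 /affine !mul1r addrC.
have s1_gt0 : 0 < s1 by rewrite lt_def s10.
have s2_gt0 : 0 < s2 by rewrite lt_def s20.
have r0 : Num.sqrt (s1 ^+ 2 + s2 ^+ 2) != 0.
  by rewrite gt_eqF// sqrtr_gt0 addr_gt0 ?exprn_gt0.
rewrite /gaussian_prob (negbTE s10) (negbTE s20) (negbTE r0).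
rewrite ge0_integral_distribution//; last exact: measurable_translation.
exact: normal_prob_conv.
Qed.

End normal_convolution.

(** * A functional monotone class theorem *)

Section polynomial_step.
Context {R : realType}.
Implicit Types (u x q r : R) (n N : nat).

Lemma bernoulli_le x N : 0 <= x -> 1 + N%:R * x <= (1 + x) ^+ N.
Proof.
move=> x0; elim: N => [|N IH]; first by rewrite mul0r addr0 expr0.
rewrite exprS; apply: (@le_trans _ _ ((1 + x) * (1 + N%:R * x))).
  have : 0 <= N%:R * x * x by rewrite !mulr_ge0.
  by rewrite -[N.+1]addn1 natrD; nra.
by rewrite ler_wpM2l ?addr_ge0.
Qed.

Lemma bernoulli_ge x N : 0 <= x <= 1 -> 1 - N%:R * x <= (1 - x) ^+ N.
Proof.
move=> /andP[x0 x1]; elim: N => [|N IH]; first by rewrite mul0r subr0 expr0.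
rewrite exprS; apply: (@le_trans _ _ ((1 - x) * (1 - N%:R * x))).
  have : 0 <= N%:R * x * x by rewrite !mulr_ge0.
  by rewrite -[N.+1]addn1 natrD; nra.
by rewrite ler_wpM2l ?subr_ge0.
Qed.

(** With [r = q * q], Bernoulli's inequality for [1/q] bounds [n * q^n], and the remaining factor
    [q^n] tends to 0. *)
Lemma cvg_natM_expr r : 0 <= r < 1 -> n%:R * r ^+ n @[n --> \oo] --> 0.
Proof.
move=> /andP[r0 r1]; pose q := Num.sqrt r.
have q0 : 0 <= q by exact: sqrtr_ge0.
have q1 : q < 1 by rewrite -[ltRHS]sqrtr1 ltr_sqrt.
have rE : r = q * q by rewrite -expr2 sqr_sqrtr.
have [qE|qn0] := eqVneq q 0.
  apply: cvg_near_cst; near=> n.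
  rewrite rE qE mul0r expr0n.
  by case: (n) => [|k]; rewrite ?mul0r ?mulr0.
have q_gt0 : 0 < q by rewrite lt_def qn0.
pose h := q^-1 - 1.
have h0 : 0 < h by rewrite subr_gt0 invf_gt1.
have nq n : n%:R * q ^+ n <= h^-1.
  rewrite -ler_pdivlMr ?exprn_gt0// -exprVn.
  have := bernoulli_le n (ltW h0); rewrite /h addrCA subrr addr0 -/h => B.
  rewrite ler_pdivlMl//.
  by apply: le_trans B; rewrite mulrC lerDr.
apply: (@squeeze_cvgr _ _ _ _ (fun=> 0) (fun n => h^-1 * q ^+ n)).
- near=> n; rewrite mulr_ge0 ?exprn_ge0//=.
  by rewrite rE exprMn mulrA ler_wpM2r ?exprn_ge0.
- exact: cvg_cst.
- rewrite -[X in _ --> X](mulr0 h^-1); apply: cvgMr.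
  by apply: cvg_expr; rewrite ger0_norm.
Unshelve. all: by end_near. Qed.

(* The exponent [n 2^n], rather than [2^n], is what makes the limit 0 at
   [u = 1/2]. *)
Lemma cvg_polynomial_step u : 0 <= u <= 1 ->
  (1 - u ^+ n) ^+ (n * 2 ^ n)%N @[n --> \oo] --> ((u < 2^-1)%R%:R : R).
Proof.
move=> /andP[u0 u1].
have un n : 0 <= u ^+ n <= 1 by rewrite exprn_ge0//= exprn_ile1.
have N2 n : (n * 2 ^ n)%N%:R = n%:R * 2 ^+ n :> R by rewrite natrM natrX.
have p0 n : 0 <= (1 - u ^+ n) ^+ (n * 2 ^ n)%N.
  by rewrite exprn_ge0// subr_ge0; case/andP: (un n).
case: ltP => [u2|u2].
- apply: (@squeeze_cvgr _ _ _ _ (fun n => 1 - n%:R * (2 * u) ^+ n) (fun=> 1)).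
  + near=> n; apply/andP; split.
      by rewrite exprMn mulrA -N2 bernoulli_ge.
    rewrite exprn_ile1// ?subr_ge0 ?lerBlDr ?lerDl; by case/andP: (un n).
  + rewrite -[X in _ --> X](subr0 (1 : R)); apply: cvgB; first exact: cvg_cst.
    by apply: cvg_natM_expr; apply/andP; split; lra.
  + exact: cvg_cst.
- apply: (@squeeze_cvgr _ _ _ _ (fun=> 0) harmonic).
  + near=> n; rewrite p0/=.
    have un0 : 0 <= u ^+ n by case/andP: (un n).
    (* The conjugate power, with [1 + u^n] as base, is at least [n + 1] by Bernoulli, because
       [(2 u)^n >= 1]. Its product with the power to be bounded is at most 1, whence the bound
       [1 / (n + 1)]. *)
    have : (1 - u ^+ n) ^+ (n * 2 ^ n)%N * (1 + u ^+ n) ^+ (n * 2 ^ n)%N <= 1.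
      rewrite -exprMn exprn_ile1//; case/andP: (un n) => a b; nra.
    have B := bernoulli_le (n * 2 ^ n)%N un0.
    have : n.+1%:R <= (1 + u ^+ n) ^+ (n * 2 ^ n)%N.
      apply: le_trans B; rewrite N2 -mulrA -exprMn -natr1 addrC lerD2l.
      by rewrite ler_peMr// exprn_ege1//; lra.
    move=> B2 B3; rewrite /harmonic/= -div1r ler_pdivlMr ?ltr0n//.
    by apply: le_trans B3; rewrite ler_wpM2l.
  + exact: cvg_cst.
  + exact: cvg_harmonic.
Unshelve. all: by end_near. Qed.

End polynomial_step.

(** Being inductive, it transports any property stable under linear operations and dominated limits;
    the uniform bound [M] is what dominated convergence asks for. Products are not a constructor, as
    orthogonality to a fixed function does not survive them; they are recovered below when products
    of generators stay in the closure. *)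
Inductive bounded_closure (R : realType) (T : Type) (K : set (T -> R)) :
    (T -> R) -> Prop :=
| bounded_closure_base f : K f -> bounded_closure K f
| bounded_closure_cst c : bounded_closure K (cst c)
| bounded_closureD f g : bounded_closure K f -> bounded_closure K g ->
    bounded_closure K (f \+ g)
| bounded_closureZ c f : bounded_closure K f ->
    bounded_closure K (fun x => c * f x)
| bounded_closure_lim (fn : (T -> R)^nat) (f : T -> R) (M : R) :
    (forall n, bounded_closure K (fn n)) -> (forall n x, `|fn n x| <= M) ->
    (forall x, fn n x @[n --> \oo] --> f x) -> bounded_closure K f.

Section bounded_closure.
Context {R : realType} {T : pointedType} (K : set (T -> R)).
Hypothesis K1 : forall f, K f -> forall x, `|f x| <= 1.
Hypothesis KM : forall f g, K f -> K g -> bounded_closure K (f \* g).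
Notation V := (bounded_closure K).

Lemma bounded_closure_bounded f : V f -> exists2 M, 0 < M & forall x, `|f x| <= M.
Proof.
elim=> {f} [f Kf|c|f g _ [M M0 fM] _ [N N0 gN]|c f _ [M M0 fM]|fn f M _ _ fnM ff].
- by exists 1 => //; exact: K1.
- by exists (`|c| + 1) => [|x]; rewrite ?ltr_wpDl// lerDl.
- exists (M + N) => [|x]; first exact: addr_gt0.
  by rewrite (le_trans (ler_normD _ _))// lerD.
- exists (`|c| * M + 1) => [|x]; first by rewrite ltr_wpDl// mulr_ge0// ltW.
  by rewrite normrM (le_trans (ler_wpM2l _ (fM x)))// lerDl.
- exists (`|M| + 1) => [|x]; first by rewrite ltr_wpDl.
  have : `|fn n x| @[n --> \oo] --> `|f x| by apply: cvg_norm; exact: ff.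
  move/(cvg_lim (@Rhausdorff _)) => <-.
  apply: limr_le.
    apply/cvg_ex; exists `|f x|; apply: cvg_norm; exact: ff.
  near=> n; rewrite (le_trans (fnM n x))// (le_trans (ler_norm _))//.
  by rewrite lerDl.
Unshelve. all: by end_near. Qed.

(** For one factor fixed, multiplication is linear and preserves bounded limits. Hence two
    successive inductions: here the left factor varies against a generator, then [bounded_closureM]
    varies the right one. *)
Let mulK f g : V f -> K g -> V (f \* g).
Proof.
move=> Vf Kg; elim: Vf => {f}
  [f Kf|c|f h _ IHf _ IHh|c f _ IHf|fn f M _ IH fnM ff].
- exact: KM.
- by apply: bounded_closureZ; exact: bounded_closure_base.
- rewrite (_ : _ \* _ = (f \* g) \+ (h \* g)); first exact: bounded_closureD.
  by apply/funext => x /=; rewrite mulrDl.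
- rewrite (_ : _ \* _ = (fun x => c * (f \* g) x)); first exact: bounded_closureZ.
  by apply/funext => x /=; rewrite mulrA.
- apply: (bounded_closure_lim (M := `|M|) IH) => [n x|x] /=.
    rewrite normrM -[`|M|]mulr1; apply: ler_pM => //; last exact: K1.
    exact: le_trans (fnM n x) (ler_norm _).
  by apply: cvgMl; exact: ff.
Qed.

Lemma bounded_closureM f g : V f -> V g -> V (f \* g).
Proof.
move=> Vf; elim=> {g} [g Kg|c|g h _ IHg _ IHh|c g _ IHg|gn g M _ IH gnM gg].
- exact: mulK.
- rewrite (_ : _ \* _ = (fun x => c * f x)); first exact: bounded_closureZ.
  by apply/funext => x /=; rewrite mulrC.
- rewrite (_ : _ \* _ = (f \* g) \+ (f \* h)); first exact: bounded_closureD.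
  by apply/funext => x /=; rewrite mulrDr.
- rewrite (_ : _ \* _ = (fun x => c * (f \* g) x)); first exact: bounded_closureZ.
  by apply/funext => x /=; rewrite mulrCA.
- have [N N0 fN] := bounded_closure_bounded Vf.
  apply: (bounded_closure_lim (M := N * `|M|) IH) => [n x|x] /=.
    rewrite normrM; apply: ler_pM => //.
    exact: le_trans (gnM n x) (ler_norm _).
  by apply: cvgMr; exact: gg.
Qed.

Lemma bounded_closureX f n : V f -> V (fun x => f x ^+ n).
Proof.
move=> Vf; elim: n => [|n IH]; first exact: bounded_closure_cst.
rewrite (_ : (fun _ => _) = f \* (fun x => f x ^+ n)).
  exact: bounded_closureM.
by apply/funext => x /=; rewrite exprS.
Qed.

Lemma bounded_closure_onem f : V f -> V (fun x => 1 - f x).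
Proof.
move=> Vf; rewrite (_ : (fun _ => _) = cst 1 \+ (fun x => -1 * f x)).
  by apply: bounded_closureD;
    [exact: bounded_closure_cst|exact: bounded_closureZ].
by apply/funext => x /=; rewrite mulN1r.
Qed.

Definition closure_sets : set (set T) := [set C | V \1_C].

Lemma closure_sets_gt0 f : V f -> closure_sets [set x | 0 < f x].
Proof.
move=> Vf; have [M M0 fM] := bounded_closure_bounded Vf.
(* This rescaling takes values in [[0, 1]] and turns [0 < f x] into [u x < 1/2], the threshold of
   the polynomial step. *)
pose u x := 2^-1 * (1 - M^-1 * f x).
have Vu : V u.
  by apply: bounded_closureZ; apply: bounded_closure_onem; exact: bounded_closureZ.
have u01 x : 0 <= u x <= 1.
  have : `|M^-1 * f x| <= 1.
    by rewrite normrM gtr0_norm ?invr_gt0// mulrC ler_pdivrMr// mul1r.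
  by rewrite ler_norml => /andP[? ?]; rewrite /u; apply/andP; split; lra.
have Vp n : V (fun x => (1 - u x ^+ n) ^+ (n * 2 ^ n)%N).
  by apply/bounded_closureX/bounded_closure_onem/bounded_closureX.
apply: (bounded_closure_lim (M := 1) Vp) => [n x|x].
  have /andP[a b] : 0 <= u x ^+ n <= 1.
    by case/andP: (u01 x) => a b; rewrite exprn_ge0//= exprn_ile1.
  by rewrite ger0_norm ?exprn_ge0 ?exprn_ile1 ?subr_ge0// lerBlDr lerDl.
rewrite indicE (_ : (x \in _) = (u x < 2^-1)); first exact: cvg_polynomial_step.
rewrite /u gtr_pMr ?invr_gt0// ltrBlDr ltrDl pmulr_rgt0 ?invr_gt0//.
by apply/idP/idP; rewrite inE.
Qed.

(** Complements come from [1 - f] and finite intersections from products; the indicator of a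
    countable union is the limit of those of the finite unions, written as complements of [G n]. *)
Lemma sigma_algebra_closure_sets : sigma_algebra [set: T] closure_sets.
Proof.
have SC A : closure_sets A -> closure_sets (~` A).
  move=> SA; rewrite /closure_sets/= (_ : \1_(~` A) = (fun x => 1 - \1_A x)).
    exact: bounded_closure_onem.
  apply/funext => x; rewrite !indicE in_setC.
  by case: (x \in A) => /=; rewrite ?subrr ?subr0.
have SI A B : closure_sets A -> closure_sets B -> closure_sets (A `&` B).
  by move=> SA SB; rewrite /closure_sets/= indicI; exact: bounded_closureM.
have S0 : closure_sets set0 by rewrite /closure_sets/= indic0; exact: bounded_closure_cst.
split=> // [A SA|F SF]; first by rewrite setTD; exact: SC.
pose G n := \big[setI/setT]_(i < n) ~` F i.
have SG n : closure_sets (G n).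
  rewrite /G; elim/big_rec: _ => [|i A _ SA]; last by apply: SI => //; exact: SC.
  by rewrite -setC0; exact: SC.
have VG n : V \1_(~` G n) by exact: SC.
apply: (bounded_closure_lim (M := 1) VG) => [n x|x].
  by rewrite indicE; case: (_ \in _); rewrite ?normr1 ?normr0.
have [[i _ Fix]|nF] := pselect ((\bigcup_i F i) x).
  apply: cvg_near_cst; near=> n.
  have ni : (i < n)%N by near: n; exact: nbhs_infty_gt.
  have GC : (~` G n) x.
    by move=> Gx; move: Gx; rewrite /G -(bigcap_mkord n (fun i => ~` F i)) => /(_ i ni).
  have UF : (\bigcup_i F i) x by exists i.
  by rewrite !indicE !mem_set.
apply: cvg_near_cst; near=> n.
have GC : ~ (~` G n) x.
  move=> nG; apply: nG; rewrite /G -(bigcap_mkord n (fun i => ~` F i)) => i _ Fix.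
  by apply: nF; exists i.
by rewrite !indicE !memNset.
Unshelve. all: by end_near. Qed.

Lemma measurable_closure_sets (X : T -> R) :
  (forall c, closure_sets [set x | c < X x]) ->
  measurable_fun [set: g_sigma_algebraType closure_sets] X.
Proof.
move=> SX; apply: (measurability _ (RGenOInfty.measurableE R)).
move=> _ [_ [c ->] <-]; rewrite setTI.
apply: sub_sigma_algebra; have := SX c; congr closure_sets.
by apply/seteqP; split=> x /=; rewrite in_itv/= andbT.
Qed.

End bounded_closure.

(** * Gaussian random variables *)

Definition mfun_of d d' (T : measurableType d) (E : measurableType d')
    (f : T -> E) (mf : measurable_fun setT f) : {mfun T >-> E} :=
  HB.pack_for {mfun T >-> E} f (isMeasurableFun.Build _ _ _ _ f mf).

Lemma measurable_preimage d d' (T : measurableType d) (E : measurableType d')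
    (f : T -> E) (A : set E) :
  measurable_fun setT f -> measurable A -> measurable (f @^-1` A).
Proof. by move=> mf mA; rewrite -[X in measurable X]setTI; exact: mf. Qed.

Lemma bounded_integrable d (T : measurableType d) (R : realType)
    (P : probability T R) (f : T -> R) (M : R) :
  measurable_fun setT f -> (forall x, `|f x| <= M) ->
  P.-integrable setT (EFin \o f).
Proof.
move=> mf fM; apply: (@le_integrable _ _ _ _ _ _ _ (EFin \o cst M)) => //.
- exact/measurable_EFinP.
- by move=> x _ /=; rewrite lee_fin (le_trans (fM x))// ler_norm.
- exact: finite_measure_integrable_cst.
Qed.

Section transfer.
Context d d' d0 (T : measurableType d) (T' : measurableType d')
  (E : measurableType d0) (R : realType).
Variables (P : probability T R) (P' : probability T' R).
Variables (X : T -> E) (X' : T' -> E).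
Hypothesis mX : measurable_fun setT X.
Hypothesis mX' : measurable_fun setT X'.
Hypothesis XX' : forall A, measurable A -> P (X @^-1` A) = P' (X' @^-1` A).

Let ge0_eq_law_integral (f : E -> \bar R) : measurable_fun setT f ->
  (forall y, 0 <= f y)%E -> (\int[P]_x f (X x) = \int[P']_x f (X' x))%E.
Proof.
move=> mf f0; pose Xm := mfun_of mX; pose Xm' := mfun_of mX'.
rewrite -[LHS](@ge0_integral_distribution _ _ _ _ _ P Xm f)//.
rewrite -[RHS](@ge0_integral_distribution _ _ _ _ _ P' Xm' f)//.
by apply: eq_measure_integral => A mA _; exact: XX'.
Qed.

Lemma eq_law_integral (f : E -> \bar R) : measurable_fun setT f ->
  (\int[P]_x f (X x) = \int[P']_x f (X' x))%E.
Proof.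
move=> mf; rewrite integralE [RHS]integralE; congr (_ - _)%E.
  rewrite (funepos_comp f X) (funepos_comp f X').
  exact: (ge0_eq_law_integral (measurable_funepos mf) (funepos_ge0 f)).
rewrite (funeneg_comp f X) (funeneg_comp f X').
exact: (ge0_eq_law_integral (measurable_funeneg mf) (funeneg_ge0 f)).
Qed.

End transfer.

Section joint_law.
Context d d1 d2 (T : measurableType d) (E1 : measurableType d1)
  (E2 : measurableType d2) (R : realType) (P : probability T R).
Variables (X : {mfun T >-> E1}) (Y : {mfun T >-> E2}).

(** The law of the pair agrees with the product measure on rectangles, and rectangles determine
    it. *)
Lemma independent_joint : independent P X Y -> forall S, measurable S ->
  ((distribution P X \x distribution P Y) S = P ((fun w => (X w, Y w)) @^-1` S))%E.
Proof.
move=> indep S mS.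
have mXY : measurable_fun setT (fun w => (X w, Y w)).
  exact: measurable_fun_pair.
pose XY := mfun_of mXY.
apply: (@product_measure_unique _ _ _ _ R _ _ (distribution P XY)) => //.
Qed.

End joint_law.

Section gaussian_rv.
Context {R : realType}.

Definition gaussian_rv d (T : measurableType d) (P : probability T R)
    (X : T -> R) (m s : R) :=
  [/\ measurable_fun setT X, 0 <= s &
      forall A, measurable A -> P (X @^-1` A) = gaussian_law m s A].

Lemma gaussian_rv_id (m s : R) : 0 <= s ->
  gaussian_rv (gaussian_prob m s) id m s.
Proof.
move=> s0; split=> //.
by move=> A mA; rewrite preimage_id gaussian_probE.
Qed.

Context d (T : measurableType d) (P : probability T R).

Lemma gaussian_rv_affine (X : T -> R) m s a b : gaussian_rv P X m s ->
  gaussian_rv P (fun w => a * X w + b) (a * m + b) (`|a| * s).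
Proof.
move=> [mX s0 X_law]; split.
- by apply: measurable_funD => //; exact: measurable_funM.
- by rewrite mulr_ge0.
move=> A mA; have [->|a0] := eqVneq a 0.
  rewrite normr0 !mul0r add0r /gaussian_law eqxx diracE.
  under [X in P (X @^-1` _)]eq_fun do rewrite mul0r add0r.
  rewrite preimage_cst; case: ifPn => _; first by rewrite probability_setT.
  by rewrite measure0.
have mpre := measurable_preimage (measurable_affine a b) mA.
have := X_law _ mpre; rewrite (gaussian_law_affine b m s a0 mA) => <-.
by [].
Qed.

Lemma gaussian_rvD (X Y : T -> R) m1 s1 m2 s2 :
  gaussian_rv P X m1 s1 -> gaussian_rv P Y m2 s2 -> independent P X Y ->
  gaussian_rv P (X \+ Y) (m1 + m2) (Num.sqrt (s1 ^+ 2 + s2 ^+ 2)).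
Proof.
move=> [mX s10 X_law] [mY s20 Y_law] indep.
split; [exact: measurable_funD|exact: sqrtr_ge0|].
move=> A mA; pose Xm := mfun_of mX; pose Ym := mfun_of mY.
pose S : set (R * R) := (fun p => p.1 + p.2) @^-1` A.
have mS : measurable S.
  by rewrite -[S]setTI; apply: measurable_funD.
have -> : P ((X \+ Y) @^-1` A) = P ((fun w => (Xm w, Ym w)) @^-1` S) by [].
rewrite -independent_joint//.
rewrite -gaussian_probE -gaussian_prob_conv//.
rewrite /product_measure1.
transitivity (\int[distribution P Xm]_x gaussian_prob m2 s2 (affine 1 x @^-1` A))%E.
  apply: eq_integral => x _ /=.
  rewrite gaussian_probE -Y_law; last first.
    by apply: measurable_preimage mA; exact: measurable_affine.
  congr (P _); apply/seteqP; split=> w;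
  by rewrite /xsection/= inE /S/= /affine mul1r addrC.
apply: eq_measure_integral => B mB _.
by transitivity (gaussian_law m1 s1 B); [exact: X_law|exact/esym/gaussian_probE].
Qed.

(** A Gaussian law is invariant under reflection about [m], so the expectation [e] satisfies
    [e = 2 m - e]; integrability makes [e] finite. *)
Lemma gaussian_rv_mean (X : T -> R) m s : gaussian_rv P X m s ->
  X \in Lfun P 1 -> ('E_P[X])%E = m%:E.
Proof.
move=> gX X1.
have [mX s0 X_law] := gX.
have [mX' _ X'_law] := gaussian_rv_affine (-1) (2 * m) gX.
have fE := expectation_fin_num X1.
have : ('E_P[X] = 'E_P[(fun w => -1 * X w + 2 * m)%R])%E.
  rewrite !unlock; apply: (@eq_law_integral _ _ _ T T R R P P X _ mX mX' _ EFin).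
    move=> A mA; rewrite (X_law _ mA) (X'_law _ mA) normrN1 mul1r.
    by have -> : -1 * m + 2 * m = m by ring.
  exact/measurable_EFinP.
rewrite (_ : (fun w => _) = cst (2 * m) \- X); last first.
  by apply/funext => w /=; ring.
rewrite expectationB ?Lfun_cst// expectation_cst.
rewrite -(fineK fE) -EFinB => -[E]; congr _%:E; lra.
Qed.

(** The variance of the standard normal law, kept symbolic: as a positive common factor it cancels
    when two finite variances are compared. *)
Definition std_variance : \bar R := (\int[gaussian_prob 0 1]_x (x ^+ 2)%:E)%E.

(** Were it zero, [x ^+ 2] would vanish almost everywhere and the law would be carried by the point
    0, which has mass 0 by absolute continuity. *)
Lemma std_variance_gt0 : (0 < std_variance)%E.
Proof.
rewrite lt_def; apply/andP; split; last first.
  by apply: integral_ge0 => x _; rewrite lee_fin sqr_ge0.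
apply/eqP => v0.
have msq : measurable_fun [set: R] (fun x : R => (x ^+ 2)%:E).
  by apply/measurable_EFinP; exact: measurable_funX.
have : ((\int[gaussian_prob (0 : R) 1]_x `|(x ^+ 2)%:E|) = 0)%E.
  rewrite -[RHS]v0.
  apply: eq_integral => x _.
  by rewrite gee0_abs// lee_fin sqr_ge0.
move/(ae_eq_integral_abs _ measurableT msq) => [N [mN N0 subN]].
have : (gaussian_prob (0 : R) 1 [set: R] <= gaussian_prob (0 : R) 1 (N `|` [set 0%R]))%E.
  apply: le_measure; rewrite ?inE//; first exact: measurableU.
  move=> x _; have [->|x0] := eqVneq x 0; [by right|left].
  apply: subN => /= /(_ I) [] /eqP.
  by rewrite sqrf_eq0 (negbTE x0).
rewrite probability_setT leNgt => /negP; apply.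
apply: le_lt_trans (measureU2 _ _ _) _ => //.
have Q0 : gaussian_prob (0 : R) 1 [set 0] = 0%E.
  rewrite gaussian_probE /gaussian_law oner_eq0.
  have /null_content_dominatesP dom := normal_prob_dominates 0 (1 : R).
  by apply: dom; [exact: measurable_set1|exact: lebesgue_measure_set1].
by rewrite [X in (X + _)%E]N0 [X in (_ + X)%E]Q0 adde0 lte01.
Qed.

End gaussian_rv.

(** [X - m] has the law of [s] times a standard normal variable. *)
Lemma gaussian_rv_variance {R : realType} d (T : measurableType d)
  (P : probability T R) (X : T -> R) (m s : R) :
  gaussian_rv P X m s -> X \in Lfun P 1 ->
  'V_P[X]%E = ((s ^+ 2)%:E * std_variance)%E.
Proof.
move=> gX X1.
have [mX s0 X_law] := gX.
have [mX' _ X'_law] := gaussian_rv_affine 1 (- m) gX.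
have [mZ _ Z_law] := gaussian_rv_affine s 0 (@gaussian_rv_id R 0 1 ler01).
rewrite /variance unlock (gaussian_rv_mean gX X1)/= unlock.
pose sq (x : R) : \bar R := (x ^+ 2)%:E.
have msq : measurable_fun [set: R] sq.
  by apply/measurable_EFinP; exact: measurable_funX.
transitivity (\int[P]_w sq (1 * X w - m)%R)%E.
  by apply: eq_integral => w _; rewrite /sq mul1r expr2.
rewrite (@eq_law_integral _ _ _ T R R R P (gaussian_prob 0 1) _ _ mX' mZ _ sq)//.
  rewrite /std_variance -ge0_integralZl//.
  - by apply: eq_integral => x _; rewrite /sq addr0 exprMn EFinM.
  - by move=> x _; rewrite lee_fin sqr_ge0.
  - by rewrite lee_fin sqr_ge0.
move=> A mA; rewrite (X'_law _ mA) (Z_law _ mA).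
by rewrite normr1 mul1r mulr0 addr0 mul1r subrr mulr1 ger0_norm.
Qed.

(** * Uncorrelated Gaussian variables are independent *)

Section orthogonality.
Context d (T : measurableType d) (R : realType) (P : probability T R).
Variables (K : set (T -> R)) (psi : T -> R) (N : R).
Hypothesis mpsi : measurable_fun setT psi.
Hypothesis psiN : forall x, `|psi x| <= N.
Hypothesis mK : forall f, K f -> measurable_fun setT f.
Hypothesis K1 : forall f, K f -> forall x, `|f x| <= 1.

Lemma bounded_closure_measurable f :
  bounded_closure K f -> measurable_fun setT f.
Proof.
elim=> {f} [f /mK//|c|f g _ mf _ mg|c f _ mf|fn f M _ mfn _ ff].
- exact: measurable_cst.
- exact: measurable_funD.
- exact: measurable_funM.
- by apply: (measurable_fun_cvg mfn) => x _; exact: ff.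
Qed.

Let integrableM f : bounded_closure K f ->
  P.-integrable setT (EFin \o (fun x => f x * psi x)).
Proof.
move=> Vf; have [M M0 fM] := bounded_closure_bounded K1 Vf.
apply: (@bounded_integrable _ _ _ _ _ (M * N)).
  by apply: measurable_funM => //; exact: bounded_closure_measurable.
by move=> x; rewrite normrM ler_pM.
Qed.

(** Orthogonality to [psi] is linear and, [psi] being bounded, passes to uniformly bounded limits by
    dominated convergence. *)
Lemma bounded_closure_orthogonal :
  \int[P]_x psi x = 0 ->
  (forall f, K f -> \int[P]_x (f x * psi x) = 0) ->
  forall f, bounded_closure K f -> \int[P]_x (f x * psi x) = 0.
Proof.
move=> psi0 Kpsi f; elim=> {f}
    [f /Kpsi//|c|f g Vf IHf Vg IHg|c f Vf IHf|fn f M Vfn IH fnM ff].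
- rewrite (RintegralZl _ measurableT) ?psi0 ?mulr0//.
  exact: (bounded_integrable _ mpsi psiN).
- under eq_Rintegral do rewrite mulrDl.
  by rewrite (RintegralD measurableT (integrableM Vf) (integrableM Vg)) IHf IHg addr0.
- under eq_Rintegral do rewrite -mulrA.
  by rewrite (RintegralZl _ measurableT (integrableM Vf)) IHf mulr0.
- have Vf : bounded_closure K f by exact: bounded_closure_lim ff.
  have mfn n : measurable_fun setT (fun x => (fn n x * psi x)%:E).
    exact: measurable_int (integrableM (Vfn n)).
  have mf := measurable_int _ (integrableM Vf).
  have cvgf : {ae P, forall x, setT x ->
      (fn n x * psi x)%:E @[n --> \oo] --> (f x * psi x)%:E}.
    by apply: aeW => x _; apply: cvg_EFin; [exact: nearW|apply: cvgMl; exact: ff].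
  have dom : {ae P, forall x n, setT x ->
      (`|(fn n x * psi x)%:E| <= (EFin \o cst (M * N)%R) x)%E}.
    by apply: aeW => x n _ /=; rewrite lee_fin normrM ler_pM.
  have iM := finite_measure_integrable_cst P (M * N) measurableT.
  have [_ _] := dominated_convergence measurableT mfn mf cvgf iM dom.
  rewrite /Rintegral => cv.
  have E n : (\int[P]_x (fn n x * psi x)%:E = 0)%E.
    rewrite -[LHS]fineK; first by congr _%:E; exact: IH.
    exact: integrable_fin_num (integrableM (Vfn n)).
  have : (\int[P]_x (fn n x * psi x)%:E)%E @[n --> \oo] --> (0 : \bar R)%E.
    by under eq_fun do rewrite E; exact: cvg_cst.
  by move/(cvg_unique (@ereal_hausdorff _) cv) => ->.
Qed.

End orthogonality.

(** * Cosines as test functions *)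

Section cosine.
Context {R : realType}.

Lemma measurable_cos : measurable_fun [set: R] (@cos R).
Proof. by apply: continuous_measurable_fun; exact: continuous_cos. Qed.

Lemma cosM (x y : R) : cos x * cos y = 2^-1 * (cos (x + y) + cos (x - y)).
Proof. by rewrite cosD cosB; field. Qed.

(** Once [x / (n + 1)] lies strictly between [-pi] and [pi], its sine has the sign of [x], so the
    sequence is eventually constant. *)
Lemma cvg_sin_gt0 (x : R) :
  (0 < sin (n.+1%:R^-1 * x))%R%:R @[n --> \oo] --> ((0 < x)%R%:R : R).
Proof.
have small : \forall n \near \oo, `|n.+1%:R^-1 * x| < pi.
  have : n.+1%:R^-1 * x @[n --> \oo] --> 0 * x.
    by apply: cvgMl; exact: cvg_harmonic.
  rewrite mul0r => /cvgr0_norm_lt; apply; exact: pi_gt0.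
apply: cvg_near_cst; near=> n.
have nx : `|n.+1%:R^-1 * x| < pi by near: n.
congr (nat_of_bool _)%:R.
have n0 : 0 < n.+1%:R^-1 :> R by rewrite invr_gt0.
have [x0|x0|->] := ltgtP x 0.
- apply/negbTE; rewrite -leNgt -oppr_ge0 -sinN ltW// sin_gt0_pi//.
  rewrite -mulrN mulr_gt0 ?oppr_gt0//= mulrN.
  by rewrite -(ltr0_norm (_ : n.+1%:R^-1 * x < 0))// pmulr_rlt0.
- rewrite sin_gt0_pi// mulr_gt0//=.
  by rewrite -(gtr0_norm (_ : 0 < n.+1%:R^-1 * x))// mulr_gt0.
- by rewrite mulr0 sin0 ltxx.
Unshelve. all: by end_near. Qed.

End cosine.

Lemma Lfun2D d (T : measurableType d) (R : realType) (P : probability T R)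
    (f g : T -> R) :
  f \in Lfun P 2%:E -> g \in Lfun P 2%:E -> f \+ g \in Lfun P 2%:E.
Proof.
have p1 : (1 <= 2%:E :> \bar R)%E by rewrite lee_fin ler1n.
by have [_] := Lfun_addr_closed P p1; exact.
Qed.

Section uncorrelated.
Context d (T : measurableType d) (R : realType) (P : probability T R).

(** The constants allow the shift by [pi / 2] that turns a cosine into a sine, and the passage from
    [c < f] to [0 < f - c]. *)
Definition affine_space (H : set (T -> R)) :=
  [/\ forall c, H (cst c), forall f g, H f -> H g -> H (f \+ g) &
      forall a f, H f -> H (fun w => a * f w)].

(** These are the real parts of characters: bounded by 1, with products that are again linear
    combinations of cosines. *)
Definition cosines (H : set (T -> R)) : set (T -> R) :=
  [set (fun w => cos (f w)) | f in H].

Section cosines.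
Variable H : set (T -> R).
Hypothesis sH : affine_space H.

Lemma cosines_le1 f : cosines H f -> forall w, `|f w| <= 1.
Proof. by move=> [g _ <-] w; exact: cos_max. Qed.

Lemma cosinesM f g : cosines H f -> cosines H g ->
  bounded_closure (cosines H) (f \* g).
Proof.
have [_ HD HZ] := sH; move=> [f' Hf <-] [g' Hg <-].
rewrite (_ : _ \* _ = (fun w => 2^-1 * ((fun w => cos ((f' \+ g') w)) \+
    (fun w => cos ((f' \+ (fun w => -1 * g' w)) w))) w)); last first.
  by apply/funext => w /=; rewrite cosM mulN1r.
apply/bounded_closureZ/bounded_closureD; apply: bounded_closure_base.
  by exists (f' \+ g') => //; exact: HD.
by exists (f' \+ (fun w => -1 * g' w)) => //; apply: HD => //; exact: HZ.
Qed.

(* [0 < f] is the limit of [0 < sin (f / n)], and a sine is a cosine of an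
   element of [H]. *)
Lemma affine_space_measurable f : H f ->
  measurable_fun [set: g_sigma_algebraType (closure_sets (cosines H))] f.
Proof.
have [Hc HD HZ] := sH; move=> Hf; apply: measurable_closure_sets => c.
pose h w := f w - c.
have Hh : H h by exact: (HD f (cst (- c))).
have S n : closure_sets (cosines H) [set w | 0 < sin (n.+1%:R^-1 * h w)].
  apply: (closure_sets_gt0 cosines_le1 cosinesM).
  apply: bounded_closure_base.
  exists ((fun w => n.+1%:R^-1 * h w) \+ cst (- (pi / 2))).
    by apply: HD => //; exact: HZ.
  by apply/funext => w /=; rewrite cosBpihalf.
apply: (bounded_closure_lim (M := 1) S) => [n w|w].
  by rewrite indicE; case: (_ \in _); rewrite ?normr1 ?normr0.
have := @cvg_sin_gt0 R (h w); rewrite subr_gt0.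
rewrite indicE mem_setE; under [X in _ -> X @ _ --> _]eq_fun do rewrite indicE mem_setE.
by [].
Qed.

End cosines.

Variables HX HY : set (T -> R).
Hypothesis sX : affine_space HX.
Hypothesis sY : affine_space HY.
Hypothesis L2X : forall f, HX f -> f \in Lfun P 2%:E.
Hypothesis L2Y : forall f, HY f -> f \in Lfun P 2%:E.
Hypothesis gaussXY : forall f g, HX f -> HY g ->
  exists m s, gaussian_rv P (f \+ g) m s.
Hypothesis uncorrelatedXY : forall f g, HX f -> HY g ->
  covariance P f g = 0%E.

Lemma eq_sqr_std_variance (s t : R) : 0 <= s -> 0 <= t ->
  ((s ^+ 2)%:E * std_variance \is a fin_num)%E ->
  ((s ^+ 2)%:E * std_variance = (t ^+ 2)%:E * std_variance :> \bar R)%E -> s = t.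
Proof.
move=> s0 t0; have := @std_variance_gt0 R.
case: std_variance => [v| |]//.
  rewrite lte_fin => v0 _ []; move/(mulIf (lt0r_neq0 v0))/eqP.
  by rewrite eqrXn2// => /eqP.
(* Case of an infinite [std_variance]: finiteness of the product forces [s = 0], and the equation
   then forces [t = 0]. *)
move=> _; have [->|sn0] := eqVneq s 0; last first.
  by rewrite gt0_muley// lte_fin exprn_gt0// lt_def sn0.
have [->//|tn0] := eqVneq t 0.
rewrite [X in _ -> _ = X -> _]gt0_muley; last first.
  by rewrite lte_fin exprn_gt0// lt_def tn0.
by rewrite expr0n/= mul0e.
Qed.

(* On [P \x P] the two summands become independent, and the resulting law is
   the same since a Gaussian law is determined by its mean and variance. *)
Lemma cosD_product f g : HX f -> HY g ->
  \int[P]_w cos (f w + g w) = \int[(P \x P)%E]_z cos (f z.1 + g z.2).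
Proof.
move=> Xf Yg.
(* Each summand is Gaussian by itself, being its sum with the constant 0 of the other space. *)
have [mf [sf]] : exists m s, gaussian_rv P f m s.
  have [m [s]] := gaussXY Xf (let: And3 h _ _ := sY in h 0).
  rewrite (_ : f \+ cst 0 = f); last by apply/funext => w /=; rewrite addr0.
  by exists m, s.
have [mg [sg]] : exists m s, gaussian_rv P g m s.
  have [m [s]] := gaussXY (let: And3 h _ _ := sX in h 0) Yg.
  rewrite (_ : cst 0 \+ g = g); last by apply/funext => w /=; rewrite add0r.
  by exists m, s.
move=> gg gf; have [m [s gfg]] := gaussXY Xf Yg.
have Pfin : P setT \is a fin_num by exact: fin_num_measure.
have f2 := L2X Xf; have g2 := L2Y Yg.
have fg2 : f \+ g \in Lfun P 2%:E by exact: Lfun2D.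
have f1 := Lfun_subset12 Pfin f2; have g1 := Lfun_subset12 Pfin g2.
have fg1 := Lfun_subset12 Pfin fg2.
have mE : m = mf + mg.
  have := gaussian_rv_mean gfg fg1.
  rewrite expectationD// (gaussian_rv_mean gf f1) (gaussian_rv_mean gg g1).
  by rewrite -EFinD => -[].
(* Zero covariance enters here: the variance of [f + g] is the sum of the variances, as for
   independent copies. *)
have sE : s = Num.sqrt (sf ^+ 2 + sg ^+ 2).
  have [_ s0 _] := gfg; apply: eq_sqr_std_variance => //.
    by rewrite -(gaussian_rv_variance gfg fg1) variance_fin_num.
  rewrite -(gaussian_rv_variance gfg fg1) varianceD// uncorrelatedXY// mule0 adde0.
  rewrite (gaussian_rv_variance gf f1) (gaussian_rv_variance gg g1).
  rewrite sqr_sqrtr ?addr_ge0 ?sqr_ge0// EFinD ge0_muleDl// lee_fin sqr_ge0//.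
have [mf_ sf0 f_law] := gf; have [mg_ sg0 g_law] := gg.
pose PP : probability (T * T)%type R := (P \x P)%E.
have XE A : (fun z : T * T => f z.1) @^-1` A = (f @^-1` A) `*` setT.
  by apply/seteqP; split=> z //= [].
have YE A : (fun z : T * T => g z.2) @^-1` A = setT `*` (g @^-1` A).
  by apply/seteqP; split=> z //= [].
have PPE A B : measurable A -> measurable B -> PP (A `*` B) = (P A * P B)%E.
  by move=> mA mB; exact: product_measure1E.
have fE A : measurable A -> PP ((fun z => f z.1) @^-1` A) = P (f @^-1` A).
  move=> mA; rewrite XE PPE ?probability_setT ?mule1//.
  exact: measurable_preimage mf_ mA.
have gE A : measurable A -> PP ((fun z => g z.2) @^-1` A) = P (g @^-1` A).
  move=> mA; rewrite YE PPE ?probability_setT ?mul1e//.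
  exact: measurable_preimage mg_ mA.
have gf' : gaussian_rv PP (fun z => f z.1) mf sf.
  split; [exact: measurableT_comp|exact: sf0|move=> A mA].
  by rewrite (fE _ mA); exact: f_law.
have gg' : gaussian_rv PP (fun z => g z.2) mg sg.
  split; [exact: measurableT_comp|exact: sg0|move=> A mA].
  by rewrite (gE _ mA); exact: g_law.
have ind : independent PP (fun z => f z.1) (fun z => g z.2).
  move=> A B mA mB; rewrite fE// gE// XE YE -setXI setIT setTI PPE//.
    exact: measurable_preimage mf_ mA.
  exact: measurable_preimage mg_ mB.
have [m1 _ law1] := gfg; have [m2 _ law2] := gaussian_rvD gf' gg' ind.
rewrite /Rintegral; congr fine.
apply: (eq_law_integral m1 m2 _ (f := fun x => (cos x)%:E)).
  by move=> A mA; rewrite (law1 _ mA) (law2 _ mA) mE sE.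
by apply/measurable_EFinP; exact: measurable_cos.
Qed.

End uncorrelated.

Lemma Lfun_measurable d (T : measurableType d) (R : realType)
    (P : probability T R) (p : \bar R) (f : T -> R) :
  f \in Lfun P p -> measurable_fun setT f.
Proof. by move=> /sub_Lfun_mfun; rewrite inE. Qed.

Lemma integrable_cos d (T : measurableType d) (R : realType)
    (P : probability T R) (f : T -> R) :
  measurable_fun setT f -> P.-integrable setT (EFin \o (fun w => cos (f w))).
Proof.
move=> mf; apply: (@bounded_integrable _ _ _ _ _ 1).
  by apply: measurableT_comp => //; exact: measurable_cos.
by move=> w; exact: cos_max.
Qed.

(** Subtracting its mean [c] from [phi] turns factorization of the expectation into orthogonality to
    [phi - c], which spreads from [K] to its closure; orthogonality to constants holds by the choice
    of [c]. *)
Lemma bounded_closure_expectationM d (T : measurableType d) (R : realType)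
    (P : probability T R) (K : set (T -> R)) (phi : T -> R) :
  measurable_fun setT phi -> (forall w, `|phi w| <= 1) ->
  (forall f, K f -> measurable_fun setT f) ->
  (forall f, K f -> forall w, `|f w| <= 1) ->
  (forall f, K f ->
    \int[P]_w (f w * phi w) = \int[P]_w f w * \int[P]_w phi w) ->
  forall f, bounded_closure K f ->
    \int[P]_w (f w * phi w) = \int[P]_w f w * \int[P]_w phi w.
Proof.
move=> mphi phi1 mK K1 KM f Vf.
pose c := \int[P]_w phi w.
have mpsi : measurable_fun setT (fun w => phi w - c) by exact: measurable_funB.
have psiN w : `|phi w - c| <= 1 + `|c|.
  by rewrite (le_trans (ler_normB _ _))// lerD2r.
have iphi := bounded_integrable P mphi phi1.
have ic : P.-integrable setT (EFin \o (fun=> c)).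
  exact: finite_measure_integrable_cst.
have psi0 : \int[P]_w (phi w - c) = 0.
  rewrite (RintegralB measurableT iphi ic) Rintegral_cst//.
  by rewrite [X in fine X](probability_setT P) mulr1 subrr.
have E (h : T -> R) (M : R) : measurable_fun setT h -> (forall w, `|h w| <= M) ->
    \int[P]_w (h w * (phi w - c)) = \int[P]_w (h w * phi w) - \int[P]_w h w * c.
  move=> mh hM; under eq_Rintegral do rewrite mulrBr.
  have ih := bounded_integrable P mh hM.
  have i1 : P.-integrable setT (EFin \o (fun w => h w * phi w)).
    apply: (@bounded_integrable _ _ _ _ _ M); first exact: measurable_funM.
    by move=> w; rewrite normrM -[M]mulr1 ler_pM.
  have i2 : P.-integrable setT (EFin \o (fun w => h w * c)).
    apply: (@bounded_integrable _ _ _ _ _ (M * `|c|)); first exact: measurable_funM.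
    by move=> w; rewrite normrM ler_wpM2r.
  by rewrite (RintegralB measurableT i1 i2) (RintegralZr _ measurableT ih).
have orth h : K h -> \int[P]_w (h w * (phi w - c)) = 0.
  by move=> Kh; rewrite (E _ _ (mK _ Kh) (K1 _ Kh)) KM// subrr.
have [M _ fM] := bounded_closure_bounded K1 Vf.
have mf := bounded_closure_measurable mK Vf.
have := bounded_closure_orthogonal mpsi psiN mK K1 psi0 orth Vf.
by rewrite (E _ _ mf fM) => /subr0_eq.
Qed.

Section uncorrelated_independent.
Context d (T : measurableType d) (R : realType) (P : probability T R).
Variables HX HY : set (T -> R).
Hypothesis sX : affine_space HX.
Hypothesis sY : affine_space HY.
Hypothesis L2X : forall f, HX f -> f \in Lfun P 2%:E.
Hypothesis L2Y : forall f, HY f -> f \in Lfun P 2%:E.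
Hypothesis gaussXY : forall f g, HX f -> HY g ->
  exists m s, gaussian_rv P (f \+ g) m s.
Hypothesis uncorrelatedXY : forall f g, HX f -> HY g ->
  covariance P f g = 0%E.

Let mcos d0 (S : measurableType d0) (f : S -> R) :
  measurable_fun setT f -> measurable_fun setT (fun w => cos (f w)).
Proof. by move=> mf; apply: measurableT_comp => //; exact: measurable_cos. Qed.

(** The product-to-sum formula leaves cosines of [f + g] and [f - g]. [cosD_product] moves each to
    [P \x P], the second by using [- g] in [HY]; there Fubini separates the factors. *)
Lemma cosM_expectation f g : HX f -> HY g ->
  \int[P]_w (cos (f w) * cos (g w)) =
  \int[P]_w cos (f w) * \int[P]_w cos (g w).
Proof.
move=> Xf Yg; have mf := Lfun_measurable (L2X Xf).
have mg := Lfun_measurable (L2Y Yg).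
have Yg' : HY (fun w => -1 * g w) by case: sY => _ _; exact.
pose PP : probability (T * T)%type R := (P \x P)%E.
pose F (z : T * T) := cos (f z.1) * cos (g z.2).
have mF : measurable_fun setT F.
  by apply: measurable_funM; apply: mcos; exact: measurableT_comp.
have F1 z : `|F z| <= 1.
  by rewrite normrM -[1]mulr1 ler_pM// cos_max.
have iF := bounded_integrable PP mF F1.
have mD d0 (S : measurableType d0) (a b : S -> R) : measurable_fun setT a ->
    measurable_fun setT b -> measurable_fun setT (fun w => a w + b w).
  by move=> ma mb; exact: measurable_funD.
have mB d0 (S : measurableType d0) (a b : S -> R) : measurable_fun setT a ->
    measurable_fun setT b -> measurable_fun setT (fun w => a w - b w).
  by move=> ma mb; exact: measurable_funB.
have cosME d0 (S : measurableType d0) (Q : probability S R) (a b : S -> R) :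
    measurable_fun setT a -> measurable_fun setT b ->
    \int[Q]_w (cos (a w) * cos (b w)) =
    2^-1 * (\int[Q]_w cos (a w + b w) + \int[Q]_w cos (a w - b w)).
  move=> ma mb; under eq_Rintegral do rewrite cosM.
  have i1 := integrable_cos Q (mD _ _ _ _ ma mb).
  have i2 := integrable_cos Q (mB _ _ _ _ ma mb).
  rewrite RintegralZl//; first by rewrite RintegralD.
  by have := integrableD measurableT i1 i2; apply: eq_integrable => // w _.
transitivity (\int[PP]_z F z).
  rewrite cosME// /F cosME; [|exact: measurableT_comp..].
  rewrite (cosD_product sX sY L2X L2Y gaussXY uncorrelatedXY Xf Yg).
  congr (_ * (_ + _)).
  transitivity (\int[P]_w cos (f w + -1 * g w)).
    by apply: eq_Rintegral => w _; rewrite mulN1r.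
  rewrite (cosD_product sX sY L2X L2Y gaussXY uncorrelatedXY Xf Yg').
  by apply: eq_Rintegral => w _; rewrite mulN1r.
rewrite /Rintegral -(fubini1 iF) /fubini_F.
have ig := integrable_cos P mg; have if_ := integrable_cos P mf.
have fing : (\int[P]_w (cos (g w))%:E)%E \is a fin_num by exact: integrable_fin_num.
have finf : (\int[P]_w (cos (f w))%:E)%E \is a fin_num by exact: integrable_fin_num.
rewrite -fineM//; congr fine.
transitivity (\int[P]_x ((cos (f x))%:E * \int[P]_w (cos (g w))%:E))%E.
  apply: eq_integral => x _.
  by rewrite -integralZl//; apply: eq_integral => y _; rewrite -EFinM.
by rewrite -(fineK fing) integralZr.
Qed.

Let Rintegral_indic (C : set T) : measurable C ->
  \int[P]_w \1_C w = fine (P C).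
Proof. by move=> mC; rewrite /Rintegral integral_indic// setIT. Qed.

(** One factor is extended at a time: a fixed cosine from [HY] first allows [cos f] to be replaced
    by [\1_C], then the fixed function [\1_C] allows the other cosine to be replaced by [\1_D]. *)
Lemma closure_sets_independent (C D : set T) :
  closure_sets (cosines HX) C -> closure_sets (cosines HY) D ->
  P (C `&` D) = (P C * P D)%E.
Proof.
move=> SC SD.
have mKX f : cosines HX f -> measurable_fun setT f.
  by move=> [h Xh <-]; apply: mcos; exact: Lfun_measurable (L2X Xh).
have mKY f : cosines HY f -> measurable_fun setT f.
  by move=> [h Yh <-]; apply: mcos; exact: Lfun_measurable (L2Y Yh).
have miC := bounded_closure_measurable mKX SC.
have mC : measurable C by exact: (measurable_indicP R C).2 miC.
have mD : measurable D.
  exact: (measurable_indicP R D).2 (bounded_closure_measurable mKY SD).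
have ind1 w : `|\1_C w : R| <= 1.
  by rewrite indicE; case: (_ \in _); rewrite ?normr1 ?normr0.
have step f : cosines HY f ->
    \int[P]_w (f w * \1_C w) = \int[P]_w f w * \int[P]_w \1_C w.
  move=> [g Yg <-]; have mg := Lfun_measurable (L2Y Yg).
  rewrite mulrC; under eq_Rintegral do rewrite mulrC.
  apply: (bounded_closure_expectationM (K := cosines HX)) SC => //.
  - exact: mcos.
  - by move=> w; exact: cos_max.
  - exact: cosines_le1.
  - by move=> _ [h Xh <-]; exact: cosM_expectation.
have := bounded_closure_expectationM miC ind1 mKY (@cosines_le1 _ _ _ HY) step SD.
rewrite !Rintegral_indic//.
under eq_Rintegral do rewrite mulrC -[\1_C _ * _]/((\1_C \* \1_D) _) -indicI.
rewrite Rintegral_indic; last exact: measurableI.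
move=> E; rewrite -(fineK (fin_num_measure P _ (measurableI _ _ mC mD))) E.
by rewrite EFinM !fineK ?fin_num_measure// muleC.
Qed.

(** The closure sets already form a sigma-algebra, so preimages under [U] and [V] are closure sets.
    Arbitrary targets are allowed so that [U] may be an entire path, whose measurability is checked
    entry by entry. *)
Theorem uncorrelated_independent d1 d2 (E1 : measurableType d1)
    (E2 : measurableType d2) (U : T -> E1) (V : T -> E2) :
  measurable_fun [set: g_sigma_algebraType (closure_sets (cosines HX))] U ->
  measurable_fun [set: g_sigma_algebraType (closure_sets (cosines HY))] V ->
  independent P U V.
Proof.
have sC (H : set (T -> R)) (sH : affine_space H) (A : set T) :
    <<s closure_sets (cosines H) >> A -> closure_sets (cosines H) A.
  rewrite sigma_algebra_id//; apply: sigma_algebra_closure_sets.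
    exact: cosines_le1.
  exact: cosinesM.
move=> mU mV A B mA mB; apply: closure_sets_independent.
  by apply: (sC _ sX); exact: measurable_preimage mU mA.
by apply: (sC _ sY); exact: measurable_preimage mV mB.
Qed.

End uncorrelated_independent.

(** * Sums of mutually independent Gaussian variables *)

Section matrix_path_measurability.
Context d d' (T : measurableType d) (E : measurableType d').

Lemma measurable_matrix m n (f : T -> 'M[E]_(m, n)) :
  (forall i j, measurable_fun setT (fun w => f w i j)) -> measurable_fun setT f.
Proof.
move=> mf; apply: measurability; first reflexivity.
move=> _ [_ [[i j] _ [A mA <-]] <-]; rewrite !setTI.
exact: measurable_preimage (mf i j) mA.
Qed.

Lemma measurable_entry m n (i : 'I_m) (j : 'I_n) :
  measurable_fun setT (fun M : 'M[E]_(m, n) => M i j).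
Proof.
move=> _ A mA; apply: sub_sigma_algebra.
by exists (i, j) => //; exists A.
Qed.

Lemma measurable_path (S : Type) (f : T -> path_space S E) :
  (forall s, measurable_fun setT (fun w => f w s)) -> measurable_fun setT f.
Proof.
move=> mf; apply: measurability; first reflexivity.
move=> _ [_ [s _ [A mA <-]] <-]; rewrite !setTI.
exact: measurable_preimage (mf s) mA.
Qed.

Lemma measurable_eval (S : Type) (s : S) :
  measurable_fun setT (fun f : path_space S E => f s).
Proof.
by move=> _ A mA; apply: sub_sigma_algebra; exists s => //; exists A.
Qed.

End matrix_path_measurability.

Section square_integrable.
Context d (T : measurableType d) (R : realType) (P : probability T R).

(** Integrability of [X] is not presupposed: [c] is a real number even if the expectation is
    infinite, where [fine] gives 0, and a finite integral of [(X - c)^2] already puts [X - c] in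
    L2. *)
Lemma Lfun2_of_covariance (X : T -> R) (v : R) :
  measurable_fun setT X -> covariance P X X = v%:E -> X \in Lfun P 2%:E.
Proof.
move=> mX; rewrite unlock; set c := fine _; rewrite unlock => XX.
pose Y := X \- cst c.
have mY : measurable_fun setT Y by exact: measurable_funB.
suff Y2 : Y \in Lfun P 2%:E.
  rewrite (_ : X = Y \+ cst c); first by apply: Lfun2D => //; exact: Lfun_cst.
  by apply/funext => w /=; rewrite /Y/= subrK.
rewrite inE/=; apply/andP; split; rewrite inE//=.
rewrite /finite_norm unlock/= poweR_lty//.
rewrite (_ : (\int[P]_x _)%E = v%:E) ?ltry// -XX.
apply: eq_integral => w _.
by rewrite /= powR_mulrn// real_normK ?num_real// expr2.
Qed.

End square_integrable.

Lemma gaussian_rv_cst d (T : measurableType d) (R : realType)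
  (P : probability T R) (c : R) : gaussian_rv P (cst c) c 0.
Proof.
split=> // A mA; rewrite /gaussian_law eqxx diracE preimage_cst.
by case: ifPn => _; rewrite ?probability_setT ?measure0.
Qed.

Section sum_of_independent.
Context d (T : measurableType d) (R : realType) (P : probability T R).
Variables (k : nat) (V : 'I_k -> T -> R).
Hypothesis gV : forall i, exists m s, gaussian_rv P (V i) m s.
Hypothesis indV : mutually_independent P V.

Let mV i : measurable_fun setT (V i).
Proof. by have [m [s []]] := gV i. Qed.

Let cyl (A : 'I_k -> set R) : set T := \bigcap_(i in [set: 'I_k]) (V i @^-1` A i).

(** The cylinders constraining only the coordinates below [j]. Keeping all [k] coordinates, with
    [setT] from [j] on, makes every one an instance of mutual independence. They generate as the
    cosines did before. *)
Let past (j : nat) : set (T -> R) :=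
  [set f | exists2 A : 'I_k -> set R,
     (forall i, measurable (A i)) /\ (forall i : 'I_k, (j <= i)%N -> A i = setT) &
     f = \1_(cyl A)].

Let mcyl A : (forall i, measurable (A i)) -> measurable (cyl A).
Proof.
move=> mA; apply: fin_bigcap_measurable => // i _.
exact: measurable_preimage.
Qed.

Let Pcyl A : (forall i, measurable (A i)) ->
  P (cyl A) = (\prod_i P (V i @^-1` A i))%E.
Proof.
move=> mA; have := indV [set: 'I_k]%SET mA.
rewrite (_ : [set` [set: 'I_k]%SET] = [set: 'I_k]); last first.
  by apply/seteqP; split=> i //= _; rewrite inE.
by move=> ->; apply: eq_bigl => i; rewrite inE.
Qed.

Let past_mul j f g : past j f -> past j g -> bounded_closure (past j) (f \* g).
Proof.
move=> [A [mA jA] ->] [B [mB jB] ->]; apply: bounded_closure_base.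
exists (fun i => A i `&` B i).
  split=> [i|i ji]; first exact: measurableI.
  by rewrite jA// jB// setTI.
rewrite -indicI; congr (\1_ _); apply/seteqP; split=> w /=.
  by move=> [a b] i _; split; [exact: a|exact: b].
by move=> ab; split=> i _; have [] := ab i I.
Qed.

Let past_le1 j f : past j f -> forall w, `|f w| <= 1.
Proof.
move=> [A _ ->] w; rewrite indicE.
by case: (_ \in _); rewrite ?normr1 ?normr0.
Qed.

Let past_measurable j f : past j f -> measurable_fun setT f.
Proof. by move=> [A [mA _] ->]; apply: measurable_indic; exact: mcyl. Qed.

(** Slot [ij] of the cylinder is still [setT], so putting [B] there gives another cylinder and the
    probabilities factor. *)
Let past_expectation j (ij : 'I_k) f B : j = ij :> nat -> measurable B -> past j f ->
  \int[P]_w (f w * \1_(V ij @^-1` B) w) =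
  \int[P]_w f w * \int[P]_w \1_(V ij @^-1` B) w.
Proof.
move=> jE mB [A [mA jA] ->].
have mVB := measurable_preimage (mV ij) mB.
have mC := mcyl mA.
under eq_Rintegral do
  rewrite -[\1_ _ _ * _]/((\1_(cyl A) \* \1_(V ij @^-1` B)) _) -indicI.
rewrite /Rintegral !integral_indic ?setIT//; last exact: measurableI.
rewrite -fineM ?fin_num_measure//; congr fine.
pose A' i := if i == ij then B else A i.
have mA' i : measurable (A' i) by rewrite /A'; case: ifP.
have -> : cyl A `&` V ij @^-1` B = cyl A'.
  apply/seteqP; split=> w /=.
    by move=> [a b] i _; rewrite /A'/=; case: eqP => [->//|_]; exact: a.
  move=> a; split=> [i _|]; last by have := a ij I; rewrite /A'/= eqxx.
  have := a i I; rewrite /A'/=; case: eqP => [->|//] _.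
  by rewrite /= jA// jE.
rewrite [LHS](Pcyl mA') [X in (X * _)%E](Pcyl mA).
rewrite (bigD1 ij)//= [in RHS](bigD1 ij)//= {1}/A' eqxx.
rewrite [in RHS]jA ?jE// preimage_setT probability_setT mul1e muleC; congr (_ * _)%E.
by apply: eq_bigr => i /negbTE ni; rewrite /A' ni.
Qed.

(** Induction on partial sums. [gaussian_rvD] asks that the partial sum be independent of the next
    term: the sum is measurable for the closure sets of [past j], to which factorization extends
    from cylinders. *)
Lemma gaussian_rv_sum : exists m s, gaussian_rv P (fun w => \sum_i V i w) m s.
Proof.
suff H j : (j <= k)%N ->
    exists m s, gaussian_rv P (fun w => \sum_(i : 'I_k | (i < j)%N) V i w) m s.
  have [m [s g]] := H k (leqnn k); exists m, s.
  rewrite (_ : (fun _ => _) = (fun w => \sum_(i : 'I_k | (i < k)%N) V i w))//.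
  by apply/funext => w; apply: eq_bigl => i; rewrite ltn_ord.
elim: j => [_|j IH jk].
  exists 0, 0; rewrite (_ : (fun _ => _) = cst 0).
    exact: gaussian_rv_cst.
  by apply/funext => w; rewrite big_pred0.
have [m1 [s1 g1]] := IH (ltnW jk).
pose ij := Ordinal jk; have [m2 [s2 g2]] := gV ij.
exists (m1 + m2), (Num.sqrt (s1 ^+ 2 + s2 ^+ 2)).
rewrite (_ : (fun _ => _) =
    (fun w => \sum_(i : 'I_k | (i < j)%N) V i w) \+ V ij); last first.
  apply/funext => w /=; rewrite (bigD1 ij)//= addrC; congr (_ + _).
  by apply: eq_bigl => i; rewrite ltnS ltn_neqAle andbC.
apply: gaussian_rvD => // A B mA mB.
have mVB := measurable_preimage (mV ij) mB.
have sg := sigma_algebra_closure_sets (@past_le1 j) (@past_mul j).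
set Sj := fun w => _.
have mSj : measurable_fun [set: g_sigma_algebraType (closure_sets (past j))] Sj.
  rewrite /Sj; under eq_fun do rewrite big_mkcond/=.
  apply: measurable_sum => i; case: (boolP (i < j)%N) => ij'; last exact: measurable_cst.
  move=> _ C mC; rewrite setTI; apply: sub_sigma_algebra.
  apply: bounded_closure_base; exists (fun l => if l == i then C else setT).
    split=> [l|l jl]; first by case: ifP.
    by case: eqP => // li; move: jl; rewrite li leqNgt ij'.
  congr (\1_ _); apply/seteqP; split=> w /=.
    by move=> CV l _ /=; case: eqP => // ->.
  by move=> /(_ i I)/=; rewrite eqxx.
have SA : closure_sets (past j) (Sj @^-1` A).
  have := measurable_preimage mSj mA.
  by rewrite /measurable/= sigma_algebra_id.
have mSA : measurable (Sj @^-1` A).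
  exact: (measurable_indicP R _).2 (bounded_closure_measurable (@past_measurable j) SA).
have ind1 w : `|\1_(V ij @^-1` B) w : R| <= 1.
  by rewrite indicE; case: (_ \in _); rewrite ?normr1 ?normr0.
have mi : measurable_fun setT (\1_(V ij @^-1` B) : T -> R).
  exact: measurable_indic.
have := bounded_closure_expectationM mi ind1
  (@past_measurable j) (@past_le1 j)
  (fun f => @past_expectation j ij f B erefl mB) SA.
under eq_Rintegral do
  rewrite -[\1_ _ _ * _]/((\1_(Sj @^-1` A) \* \1_(V ij @^-1` B)) _) -indicI.
rewrite /Rintegral !integral_indic ?setIT//; last exact: measurableI.
rewrite -fineM ?fin_num_measure// => E.
rewrite -[LHS]fineK ?fin_num_measure//; last exact: measurableI.
by rewrite E fineK// fin_numM// fin_num_measure.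
Qed.

End sum_of_independent.

(** * The Gaussian space of signal and noise *)

Section covariance_linear.
Context d (T : measurableType d) (R : realType) (P : probability T R).

Lemma Lfun21 (X : T -> R) : X \in Lfun P 2%:E -> X \in Lfun P 1.
Proof. by apply: Lfun_subset12; exact: fin_num_measure. Qed.

Lemma Lfun2Z (a : R) (X : T -> R) :
  X \in Lfun P 2%:E -> (fun w => a * X w) \in Lfun P 2%:E.
Proof.
move=> X2; rewrite (_ : (fun _ => _) = a \o* X); first by rewrite Lfun_scale// ler1n.
by apply/funext => w /=; rewrite mulrC.
Qed.

Lemma Lfun2_sum (I : Type) (s : seq I) (Q : pred I) (X : I -> T -> R) :
  (forall i, X i \in Lfun P 2%:E) ->
  (fun w => \sum_(i <- s | Q i) X i w) \in Lfun P 2%:E.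
Proof.
move=> X2; elim: s => [|i s IH].
  by under eq_fun do rewrite big_nil; exact: Lfun_cst.
under eq_fun do rewrite big_cons; case: (Q i) => //.
exact: Lfun2D.
Qed.

Lemma covarianceZl2 (a : R) (X Y : T -> R) :
  X \in Lfun P 2%:E -> Y \in Lfun P 2%:E ->
  covariance P (fun w => a * X w) Y = (a%:E * covariance P X Y)%E.
Proof.
move=> X2 Y2; rewrite (_ : (fun _ => _) = a \o* X).
  apply: covarianceZl; [exact: Lfun21|exact: Lfun21|].
  exact: Lfun2_mul_Lfun1.
by apply/funext => w /=; rewrite mulrC.
Qed.

Lemma covariance_suml (I : Type) (s : seq I) (Q : pred I) (a : I -> R)
    (X : I -> T -> R) (Y : T -> R) (v : I -> R) :
  (forall i, X i \in Lfun P 2%:E) -> Y \in Lfun P 2%:E ->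
  (forall i, covariance P (X i) Y = (v i)%:E) ->
  covariance P (fun w => \sum_(i <- s | Q i) a i * X i w) Y =
  (\sum_(i <- s | Q i) a i * v i)%:E.
Proof.
move=> X2 Y2 XY; elim: s => [|i s IH].
  by under eq_fun do rewrite big_nil; rewrite big_nil covariance_cst_l.
rewrite big_cons; under eq_fun do rewrite big_cons; case: (Q i) => //.
have aX2 l : (fun w => a l * X l w) \in Lfun P 2%:E by exact: Lfun2Z.
rewrite (covarianceDl (X := fun w => a i * X i w)
  (Y := fun w => \sum_(l <- s | Q l) a l * X l w))//; last exact: Lfun2_sum.
by rewrite IH covarianceZl2// XY EFinD EFinM.
Qed.

Lemma expectation_lin (I : Type) (s : seq I) (Q : pred I) (a : I -> R)
    (X : I -> T -> R) (v : I -> R) :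
  (forall i, X i \in Lfun P 2%:E) -> (forall i, 'E_P[X i] = (v i)%:E)%E ->
  ('E_P[(fun w => \sum_(i <- s | Q i) a i * X i w)%R] =
   (\sum_(i <- s | Q i) a i * v i)%:E)%E.
Proof.
move=> X2 EX; elim: s => [|i s IH].
  by under eq_fun do rewrite big_nil; rewrite big_nil expectation_cst.
rewrite big_cons; under eq_fun do rewrite big_cons; case: (Q i) => //.
have aX2 l : (fun w => a l * X l w) \in Lfun P 2%:E by exact: Lfun2Z.
have S2 : (fun w => \sum_(l <- s | Q l) a l * X l w) \in Lfun P 2%:E.
  exact: Lfun2_sum.
rewrite (expectationD (X := fun w => a i * X i w)
  (Y := fun w => \sum_(l <- s | Q l) a l * X l w)) ?Lfun21//.
rewrite IH EFinD; congr (_ + _)%E.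
rewrite (_ : (fun w => a i * X i w) = a i \o* X i).
  by rewrite expectationZl ?Lfun21// EX EFinM.
by apply/funext => w /=; rewrite mulrC.
Qed.

(** The convolution shows that the variance of the sum is the sum of the variances; comparison with
    the general formula leaves twice the covariance equal to 0. *)
Lemma gaussian_independent_cov0 (X Y : T -> R) m1 s1 m2 s2 :
  gaussian_rv P X m1 s1 -> gaussian_rv P Y m2 s2 ->
  X \in Lfun P 2%:E -> Y \in Lfun P 2%:E -> independent P X Y ->
  covariance P X Y = 0%E.
Proof.
move=> gX gY X2 Y2 ind; have gD := gaussian_rvD gX gY ind.
have D2 := Lfun2D X2 Y2.
have VD := gaussian_rv_variance gD (Lfun21 D2).
have VX := gaussian_rv_variance gX (Lfun21 X2).
have VY := gaussian_rv_variance gY (Lfun21 Y2).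
have : ('V_P[(X \+ Y)%R] = 'V_P[X] + 'V_P[Y])%E.
  rewrite VD VX VY sqr_sqrtr ?addr_ge0 ?sqr_ge0// EFinD.
  by rewrite ge0_muleDl// lee_fin sqr_ge0.
rewrite varianceD//.
have := variance_fin_num X2; have := variance_fin_num Y2.
have c1 : covariance P X Y \is a fin_num.
  by apply: covariance_fin_num; [exact: Lfun21..|exact: Lfun2_mul_Lfun1].
move=> /fineK <- /fineK <-; rewrite -(fineK c1) -EFinM -!EFinD => -[] E.
by congr _%:E; lra.
Qed.

End covariance_linear.

Section signal_noise.
Context (R : realType) (S : Type) (n q k : nat) d (T : measurableType d)
  (P : probability T R).
Variables (F : S -> {RV P >-> 'M[R]_(n, q)}) (w : 'I_k -> {RV P >-> 'cV[R]_n}).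
Variables (mu : S -> 'cV[R]_(q * n)) (K : S -> S -> 'M[R]_(q * n)) (Sw : 'M[R]_n).
Hypothesis gF : gaussian_process P (fun x omega => vec (F x omega)) mu K.
Hypothesis gw : forall i, gaussian_vector P (w i) 0 Sw.
Hypothesis iw : mutually_independent P (fun i => w i).
Hypothesis iFw : independent P (sample_path (fun x => F x))
  (fun omega => \matrix_(r < n, i < k) w i omega r 0).

Definition path_term (t : S * ('I_n * 'I_q)) (omega : T) : R :=
  F t.1 omega t.2.1 t.2.2.

Definition noise_term (t : 'I_k * 'I_n) (omega : T) : R := w t.1 omega t.2 0.

(** Lists reach all finite combinations over an arbitrary index type [S]; addition of forms is
    concatenation, and repeated points are harmless since marginals allow them. *)
Definition path_form (s : seq (S * ('I_n * 'I_q) * R)) (omega : T) : R :=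
  \sum_(t <- s) t.2 * path_term t.1 omega.

Definition noise_form (b : 'I_k * 'I_n -> R) (omega : T) : R :=
  \sum_i b i * noise_term i omega.

Definition gauss_space : set (T -> R) :=
  [set f | exists c s b, f = fun omega => c + (path_form s omega + noise_form b omega)].

Lemma measurable_path_term t : measurable_fun setT (path_term t).
Proof.
exact: (measurableT_comp (measurable_entry t.2.1 t.2.2) (measurable_funPT (F t.1))).
Qed.

Lemma measurable_noise_term t : measurable_fun setT (noise_term t).
Proof.
exact: (measurableT_comp (measurable_entry t.2 0) (measurable_funPT (w t.1))).
Qed.

Lemma path_form_gaussian s : exists m v, gaussian_rv P (path_form s) m v.
Proof.
pose t (i : 'I_(size s)) := tnth (in_tuple s) i.
have [[_ +] _ _] := gF (fun i => (t i).1.1).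
(* The marginal has one point per list item; [c] selects from item [i.1] its single entry, at the
   column-stacked index of [vec]. *)
pose c (i : 'I_(size s) * 'I_(q * n)) : R :=
  if i.2 == mxtens_index ((t i.1).1.2.2, (t i.1).1.2.1) then (t i.1).2 else 0.
move=> /(_ c) [m [v [v0 law]]]; exists m, v.
have E : path_form s =
    (fun omega => \sum_i c i * vec (F (t i.1).1.1 omega) i.2 0).
  apply/funext => omega.
  rewrite -(pair_bigA _ (fun a r => c (a, r) * vec (F (t a).1.1 omega) r 0))/=.
  rewrite /path_form [LHS]big_tnth; apply: eq_bigr => a _.
  rewrite (bigD1 (mxtens_index ((t a).1.2.2, (t a).1.2.1)))//= big1 ?addr0.
    by rewrite /c/= eqxx mxE mxtens_indexK.
  by move=> r /negbTE ne; rewrite /c/= ne mul0r.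
split=> //; last by rewrite E; exact: law.
by apply: measurable_sum => i; apply: measurable_funM => //; exact: measurable_path_term.
Qed.

(** Grouped by [i], the form is a sum of mutually independent terms, each Gaussian as a linear form
    in one noise vector. *)
Lemma noise_form_gaussian b : exists m v, gaussian_rv P (noise_form b) m v.
Proof.
pose V i omega := \sum_r b (i, r) * w i omega r 0.
have mVcV i : measurable_fun setT (fun x : 'cV[R]_n => \sum_r b (i, r) * x r 0).
  by apply: measurable_sum => r; apply: measurable_funM => //; exact: measurable_entry.
have gV i : exists m s, gaussian_rv P (V i) m s.
  have [[_ +] _ _] := gw i; move=> /(_ (fun r => b (i, r))) [m [s [s0 law]]].
  exists m, s; split=> //.
  by apply: measurableT_comp (mVcV i) _.
have iV : mutually_independent P V.
  move=> J A mA.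
  have := iw J (A := fun i => (fun x : 'cV[R]_n => \sum_r b (i, r) * x r 0) @^-1` A i).
  by apply=> i; exact: measurable_preimage.
have [m [s g]] := gaussian_rv_sum gV iV; exists m, s.
rewrite (_ : noise_form b = (fun omega => \sum_i V i omega))//.
apply/funext => omega; rewrite /V pair_bigA/=.
by apply: eq_bigr => -[].
Qed.

Lemma path_noise_independent s b : independent P (path_form s) (noise_form b).
Proof.
move=> A B mA mB.
pose phi (f : path_space S 'M[R]_(n, q)) :=
  \sum_(t <- s) t.2 * f t.1.1 t.1.2.1 t.1.2.2.
pose chi (M : 'M[R]_(n, k)) := \sum_i b i * M i.2 i.1.
have mphi : measurable_fun setT phi.
  apply: measurable_sum => t; apply: measurable_funM => //.
  exact: (measurableT_comp (measurable_entry t.1.2.1 t.1.2.2) (measurable_eval t.1.1)).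
have mchi : measurable_fun setT chi.
  by apply: measurable_sum => t; apply: measurable_funM => //; exact: measurable_entry.
have := iFw (measurable_preimage mphi mA) (measurable_preimage mchi mB).
have chiE omega :
    chi (\matrix_(r < n, i < k) w i omega r 0) = noise_form b omega.
  by apply: eq_bigr => i _; rewrite mxE.
rewrite (_ : _ @^-1` (chi @^-1` B) = noise_form b @^-1` B)//.
by apply/seteqP; split=> omega /=; rewrite chiE.
Qed.

Lemma gauss_space_gaussian f : gauss_space f -> exists m s, gaussian_rv P f m s.
Proof.
move=> [c [s [b ->]]].
have [m1 [s1 g1]] := path_form_gaussian s.
have [m2 [s2 g2]] := noise_form_gaussian b.
have g := gaussian_rv_affine 1 c (gaussian_rvD g1 g2 (path_noise_independent s b)).
exists (1 * (m1 + m2) + c), (`|1| * Num.sqrt (s1 ^+ 2 + s2 ^+ 2)).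
rewrite (_ : (fun _ => _) =
  (fun omega => 1 * (path_form s \+ noise_form b) omega + c))//.
by apply/funext => omega /=; rewrite mul1r addrC.
Qed.

Lemma gauss_space_affine : affine_space gauss_space.
Proof.
split=> [c|_ _ [c [s [b ->]]] [c' [s' [b' ->]]]|a _ [c [s [b ->]]]].
- exists c, [::], (fun=> 0); apply/funext => omega.
  by rewrite /path_form big_nil /noise_form big1 ?addr0// => i _; rewrite mul0r.
- exists (c + c'), (s ++ s'), (fun i => b i + b' i); apply/funext => omega /=.
  rewrite /path_form /noise_form big_cat/=.
  under [X in _ = _ + (_ + X)]eq_bigr do rewrite mulrDl.
  by rewrite big_split/=; ring.
- exists (a * c), [seq (t.1, a * t.2) | t <- s], (fun i => a * b i).
  apply/funext => omega; rewrite /path_form /noise_form big_map/=.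
  under [X in _ = _ + (X + _)]eq_bigr do rewrite -mulrA.
  under [X in _ = _ + (_ + X)]eq_bigr do rewrite -mulrA.
  by rewrite -!mulr_sumr -!mulrDr.
Qed.

Lemma gauss_space_path t : gauss_space (path_term t).
Proof.
exists 0, [:: (t, 1)], (fun=> 0); apply/funext => omega.
rewrite /path_form big_seq1 /noise_form big1 ?addr0 ?add0r ?mul1r//.
by move=> i _; rewrite mul0r.
Qed.

Lemma gauss_space_noise t : gauss_space (noise_term t).
Proof.
exists 0, [::], (fun i => (i == t)%:R); apply/funext => omega.
rewrite /path_form big_nil /noise_form (bigD1 t)//= eqxx mul1r big1 ?addr0 ?add0r//.
by move=> i /negbTE ->; rewrite mul0r.
Qed.

Lemma gauss_space_sum (I : Type) (s : seq I) (X : I -> T -> R) (a : I -> R) :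
  (forall i, gauss_space (X i)) ->
  gauss_space (fun omega => \sum_(i <- s) a i * X i omega).
Proof.
have [Hc HD HZ] := gauss_space_affine; move=> HX; elim: s => [|i s IH].
  by under eq_fun do rewrite big_nil; exact: Hc.
by under eq_fun do rewrite big_cons; apply: HD => //; exact: HZ.
Qed.

Lemma path_term_cov x r c x' r' c' :
  covariance P (path_term (x, (r, c))) (path_term (x', (r', c'))) =
  (K x x' (mxtens_index (c, r)) (mxtens_index (c', r')))%:E.
Proof.
(* A marginal at two points, valid also for [x = x'], where it yields the variances. *)
pose y (i : 'I_2) := if i == ord0 then x else x'.
have [_ _ /(_ (ord0, mxtens_index (c, r)) (ord_max, mxtens_index (c', r')))] := gF y.
rewrite /y/= => <-; congr (covariance P _ _);
by apply/funext => omega; rewrite /path_term mxE mxtens_indexK.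
Qed.

Lemma path_term_mean x r c :
  ('E_P[path_term (x, (r, c))] = (mu x (mxtens_index (c, r)) 0)%:E)%E.
Proof.
have [_ /(_ (ord0, mxtens_index (c, r))) + _] := gF (fun _ : 'I_1 => x).
move=> /= <-; congr expectation.
by apply/funext => omega; rewrite /path_term mxE mxtens_indexK.
Qed.

Lemma path_term_L2 t : path_term t \in Lfun P 2%:E.
Proof.
case: t => x [r c]; apply: Lfun2_of_covariance (path_term_cov _ _ _ _ _ _).
exact: measurable_path_term.
Qed.

Lemma noise_term_mean t : ('E_P[noise_term t] = 0)%E.
Proof. by have [_ /(_ t.2) + _] := gw t.1; rewrite mxE. Qed.

Lemma noise_term_cov_diag i r r' :
  covariance P (noise_term (i, r)) (noise_term (i, r')) = (Sw r r')%:E.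
Proof. by have [_ _ /(_ r r')] := gw i. Qed.

Lemma noise_term_L2 t : noise_term t \in Lfun P 2%:E.
Proof.
case: t => i r; apply: Lfun2_of_covariance (noise_term_cov_diag _ _ _).
exact: measurable_noise_term.
Qed.

Lemma gauss_space_L2 f : gauss_space f -> f \in Lfun P 2%:E.
Proof.
move=> [c [s [b ->]]].
apply: (Lfun2D (f := cst c)); first exact: Lfun_cst.
apply: Lfun2D; apply: Lfun2_sum => t; apply: Lfun2Z.
  exact: path_term_L2.
exact: noise_term_L2.
Qed.

Lemma noise_term_cov i r j r' :
  covariance P (noise_term (i, r)) (noise_term (j, r')) =
  (if i == j then Sw r r' else 0)%:E.
Proof.
case: eqP => [<-|/eqP ij]; first exact: noise_term_cov_diag.
have [m1 [s1 g1]] := gauss_space_gaussian (gauss_space_noise (i, r)).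
have [m2 [s2 g2]] := gauss_space_gaussian (gauss_space_noise (j, r')).
apply: (gaussian_independent_cov0 g1 g2); try exact: noise_term_L2.
move=> A B mA mB.
have mE r0 C : measurable C -> measurable ((fun x : 'cV[R]_n => x r0 0 : R) @^-1` C).
  by move=> mC; apply: measurable_preimage mC; exact: measurable_entry.
pose D l : set 'cV[R]_n :=
  if l == i then (fun x : 'cV[R]_n => x r 0 : R) @^-1` A
  else (fun x : 'cV[R]_n => x r' 0 : R) @^-1` B.
have mD l : measurable (D l) by rewrite /D; case: ifP => _; exact: mE.
have ji : (j == i) = false by rewrite eq_sym (negbTE ij).
have := iw [set i; j]%SET mD.
rewrite big_setU1 ?inE ?(negbTE ij)//= big_set1 /D eqxx ji => <-.
congr (P _); apply/seteqP; split=> omega /=.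
  move=> [a b] l /=; rewrite !inE => /orP[/eqP ->|/eqP ->].
    by rewrite eqxx.
  by rewrite ji.
move=> ab; split.
  by have := ab i; rewrite /= !inE eqxx; apply.
by have := ab j; rewrite /= !inE eqxx orbT ji; apply.
Qed.

Lemma path_noise_cov t t' : covariance P (path_term t) (noise_term t') = 0%E.
Proof.
have [m1 [s1 g1]] := gauss_space_gaussian (gauss_space_path t).
have [m2 [s2 g2]] := gauss_space_gaussian (gauss_space_noise t').
apply: (gaussian_independent_cov0 g1 g2).
- exact: path_term_L2.
- exact: noise_term_L2.
have := path_noise_independent [:: (t, 1)] (fun i => (i == t')%:R).
rewrite (_ : path_form _ = path_term t); last first.
  by apply/funext => omega; rewrite /path_form big_seq1 mul1r.
rewrite (_ : noise_form _ = noise_term t')//.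
apply/funext => omega; rewrite /noise_form (bigD1 t')//= eqxx mul1r big1 ?addr0//.
by move=> i /negbTE ->; rewrite mul0r.
Qed.

End signal_noise.

(** * Conditional laws and the Gram matrix *)

Section pushforward_moments.
Context d d' (T : measurableType d) (E : measurableType d') (R : realType).
Variables (P : probability T R) (X : {mfun T >-> E}).

Lemma expectation_distribution (f : E -> R) : measurable_fun setT f ->
  ('E_(distribution P X)[f] = 'E_P[f \o X])%E.
Proof.
move=> mf; rewrite !unlock.
by apply: (@eq_law_integral _ _ _ E T E R (distribution P X) P id X
  (@measurable_id _ _ _) (measurable_funPT X) _ (EFin \o f)) => //;
  exact/measurable_EFinP.
Qed.

Lemma covariance_distribution (f g : E -> R) :
  measurable_fun setT f -> measurable_fun setT g ->
  covariance (distribution P X) f g = covariance P (f \o X) (g \o X).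
Proof.
move=> mf mg; rewrite !covariance.unlock.
rewrite (expectation_distribution mf) (expectation_distribution mg).
rewrite expectation_distribution//.
by apply: measurable_funM; exact: measurable_funB.
Qed.

End pushforward_moments.

Section independent_kernel.
Context d d1 d2 d3 (T : measurableType d) (E1 : measurableType d1)
  (E2 : measurableType d2) (E3 : measurableType d3) (R : realType)
  (P : probability T R).
Variables (Y : {mfun T >-> E2}) (Z : {mfun T >-> E3}) (G : E2 * E3 -> E1).
Hypothesis mG : measurable_fun setT G.
Hypothesis indYZ : independent P Y Z.
Variable kappa : E2 -> probability E1 R.
Hypothesis kappaE : forall y C, measurable C ->
  kappa y C = P ((fun w => G (y, Z w)) @^-1` C).

(** The freezing principle: for independent [Y] and [Z], conditioning on [Y = y] replaces [Y] by [y]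
    and leaves the law of [Z] unchanged. *)
Lemma conditional_distribution_of_independent :
  conditional_distribution P (fun w => G (Y w, Z w)) Y kappa.
Proof.
have kE C : measurable C -> (fun y => kappa y C) =
    (fun y => distribution P Z (xsection (G @^-1` C) y)).
  move=> mC; apply/funext => y; rewrite kappaE//; congr (P _).
  by apply/seteqP; split=> w; rewrite /= /xsection/= inE.
have mk C : measurable C -> measurable_fun setT (kappa ^~ C).
  move=> mC; rewrite (kE _ mC).
  exact: (measurable_fun_xsection (distribution P Z) (measurable_preimage mG mC)).
split=> // C D mC mD.
have mS : measurable (G @^-1` C `&` (D `*` setT)).
  by apply: measurableI; [exact: measurable_preimage|exact: measurableX].
rewrite -[RHS](@ge0_integral_pushforward _ _ _ _ R Y (measurable_funPT Y) P D
  (kappa ^~ C))//; last exact: measurable_funTS (mk _ mC).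
(* The two events become one event for the pair [(Y, Z)]. Its section at [y] is empty outside [D],
   and for [y] in [D] it is the event defining [kappa y C]. *)
have -> : (fun w => G (Y w, Z w)) @^-1` C `&` Y @^-1` D =
    (fun w => (Y w, Z w)) @^-1` (G @^-1` C `&` (D `*` setT)).
  by apply/seteqP; split=> w /=; [move=> [a b]|move=> [a [b _]]]; do ?split.
rewrite -independent_joint// /product_measure1 [RHS]integral_mkcond.
apply: eq_integral => y _ /=; rewrite patchE; case: ifPn => [/set_mem yD|/negP yD].
  rewrite kappaE//; congr (P _); apply/seteqP; split=> w.
    by rewrite /= /xsection/= inE/= => -[].
  by move=> GC; rewrite /= /xsection/= inE.
rewrite (_ : xsection _ _ = set0) ?measure0//.
apply/seteqP; split=> z //; rewrite /xsection/= inE/= => -[_ [yD' _]].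
by apply: yD; rewrite inE.
Qed.

End independent_kernel.

(** * Normal equations of the regression *)

Section gram_matrix.
Context {R : realType} {n m k : nat}.
Variables (M0 : 'cV[R]_n -> 'M[R]_(n, 1 + m))
          (B0 : 'cV[R]_n -> 'cV[R]_n -> 'M[R]_(1 + m)).
Variables (sigma : R) (xs : 'I_k -> 'cV[R]_n) (us : 'I_k -> 'cV[R]_m).
Hypothesis B0_psd : psd_kernel B0.
Hypothesis sigma_gt0 : 0 < sigma.

(** [cross_mx] and [gram_mx] are the input factors of the covariances of [F x] with the observations
    and of the observations among themselves; in both the output factor is an entry of [A]. *)
Definition cross_mx x : 'M[R]_(1 + m, k) := calBx B0 xs x *m calU us.

Definition gram_mx : 'M[R]_k :=
  (calU us)^T *m calB B0 xs *m calU us + (sigma ^+ 2)%:M.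

Let mulmx_calU p (A : 'I_k -> 'M[R]_(p, 1 + m)) r i :
  ((\mxrow_(l < k) A l) *m calU us) r i = (A i *m underline (us i)) r 0.
Proof.
rewrite /calU mul_mxrow_mxcol summxE (bigD1 i)//= big1 ?addr0.
  by rewrite !mxE; apply: eq_bigr => c _; rewrite !mxE eqxx.
move=> l /negbTE li; rewrite !mxE big1// => c _.
by rewrite !mxE li mulr0.
Qed.

Lemma calM_calUE r i :
  (calM M0 xs *m calU us) r i = (M0 (xs i) *m underline (us i)) r 0.
Proof. exact: mulmx_calU. Qed.

Lemma cross_mxE x c i :
  cross_mx x c i = (B0 x (xs i) *m underline (us i)) c 0.
Proof. exact: mulmx_calU. Qed.

Lemma gram_mxE i j : gram_mx i j =
  ((underline (us i))^T *m (B0 (xs i) (xs j) *m underline (us j))) 0 0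
  + (if i == j then sigma ^+ 2 else 0).
Proof.
rewrite /gram_mx mxE; congr (_ + _); last first.
  by rewrite mxE; case: eqP => _; rewrite ?mulr1n ?mulr0n.
have -> : (calU us)^T *m calB B0 xs *m calU us
    = (calU us)^T *m \mxcol_(l < k) (cross_mx (xs l)).
  rewrite -mulmxA; congr (_ *m _).
  by rewrite /calB mxblockEv mxcol_mul.
rewrite /calU tr_mxcol mul_mxrow_mxcol summxE (bigD1 i)//= big1 ?addr0.
  rewrite [LHS]mxE [RHS]mxE; apply: eq_bigr => c _.
  by rewrite -cross_mxE ![(_^T) _ _]mxE mxE eqxx.
move=> l /negbTE li; rewrite mxE big1// => c _.
by rewrite !mxE li mul0r.
Qed.

Lemma gram_mx_sym : gram_mx^T = gram_mx.
Proof.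
have [B0T _] := B0_psd.
apply/matrixP => i j; rewrite mxE !gram_mxE [j == i]eq_sym; congr (_ + _).
rewrite -[LHS]trace_mx11 -mxtrace_tr !trmx_mul trmxK B0T mulmxA.
by rewrite trace_mx11.
Qed.

(** On a kernel vector [v] the quadratic form is 0, yet it is the sum of a kernel form at the
    vectors [v 0 i *: underline (us i)], nonnegative by [B0_psd], and of [sigma ^+ 2] times the
    squared norm of [v]. *)
Lemma gram_mx_unit : gram_mx \in unitmx.
Proof.
rewrite unitmxE unitfE; apply/negP => /det0P[v v0 vG].
have [_ /(_ k xs (fun i => v 0 i *: underline (us i)))] := B0_psd.
rewrite summxE => psd.
have : (v *m gram_mx *m v^T) 0 0 = 0 by rewrite vG mul0mx mxE.
have -> : (v *m gram_mx *m v^T) 0 0 = 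
  \sum_i (\sum_j ((v 0 i *: underline (us i))^T *m B0 (xs i) (xs j) *m
     (v 0 j *: underline (us j)))) 0 0 + sigma ^+ 2 * \sum_i v 0 i ^+ 2.
  rewrite mxE.
  under eq_bigr do rewrite mxE big_distrl/=.
  rewrite exchange_big/= mulr_sumr -big_split/=; apply: eq_bigr => i _.
  rewrite summxE.
  rewrite [X in _ = X + _](eq_bigr (fun j => v 0 i * v 0 j *
    ((underline (us i))^T *m (B0 (xs i) (xs j) *m underline (us j))) 0 0)); last first.
    move=> j _; rewrite [(_ *: _)^T]linearZ/= -scalemxAr -!scalemxAl scalerA.
    by rewrite mxE -mulmxA [v 0 j * _]mulrC.
  under eq_bigr do rewrite gram_mxE mulrDr mulrDl ![v^T _ _]mxE.
  rewrite big_split/=; congr (_ + _).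
    by apply: eq_bigr => j _; ring.
  rewrite (bigD1 i)//= eqxx big1 ?addr0.
    by ring.
  by move=> j /negbTE; rewrite eq_sym => ->; rewrite mulr0 mul0r.
move/eqP; rewrite paddr_eq0//; last first.
  by rewrite mulr_ge0 ?sqr_ge0// sumr_ge0// => i _; exact: sqr_ge0.
case/andP => _; rewrite mulf_eq0 sqrf_eq0 gt_eqF//= psumr_eq0; last first.
  by move=> i _; exact: sqr_ge0.
move=> /allP v00; case/negP: v0; apply/eqP/rowP => i.
by have := v00 i (mem_index_enum _); rewrite sqrf_eq0 mxE => /eqP.
Qed.

Lemma DkE x : Dk B0 sigma xs us x = invmx gram_mx *m (cross_mx x)^T.
Proof. by rewrite /Dk /cross_mx trmx_mul mulmxA. Qed.

(** The normal equations, which make the residual uncorrelated with the observations. *)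
Lemma trDk_gram x : (Dk B0 sigma xs us x)^T *m gram_mx = cross_mx x.
Proof.
rewrite DkE trmx_mul trmxK trmx_inv gram_mx_sym -mulmxA mulVmx ?mulmx1//.
exact: gram_mx_unit.
Qed.

Lemma trDk_cross x x' :
  (Dk B0 sigma xs us x)^T *m (cross_mx x')^T = cross_mx x *m Dk B0 sigma xs us x'.
Proof. by rewrite !DkE trmx_mul trmxK trmx_inv gram_mx_sym mulmxA. Qed.

End gram_matrix.

(** * The posterior *)

Section posterior.
Context (R : realType) (n m k : nat) (d : measure_display)
  (T : measurableType d) (P : probability T R).
Variables (A : 'M[R]_n) (M0 : 'cV[R]_n -> 'M[R]_(n, 1 + m))
    (B0 : 'cV[R]_n -> 'cV[R]_n -> 'M[R]_(1 + m)) (sigma : R)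
    (xs : 'I_k -> 'cV[R]_n) (us : 'I_k -> 'cV[R]_m)
    (F : 'cV[R]_n -> {RV P >-> 'M[R]_(n, 1 + m)})
    (w : 'I_k -> {RV P >-> 'cV[R]_n})
    (dX : {RV P >-> 'M[R]_(n, k)}).
Hypothesis AT : A^T = A.
Hypothesis B0_psd : psd_kernel B0.
Hypothesis sigma_gt0 : 0 < sigma.
Hypothesis gF : gaussian_process P (fun x omega => vec (F x omega))
    (fun x => vec (M0 x)) (fun x x' => B0 x x' *t A).
Hypothesis gw : forall i, gaussian_vector P (w i) 0 (sigma ^+ 2 *: A).
Hypothesis iw : mutually_independent P (fun i => w i).
Hypothesis iFw : independent P (sample_path (fun x => F x))
    (fun omega => \matrix_(r < n, i < k) w i omega r 0).
Hypothesis dXE : forall i omega,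
     col i (dX omega) = F (xs i) omega *m underline (us i) + w i omega.

Notation H := (gauss_space F w).
Notation pt := (path_term F).
Notation nt := (noise_term w).
Notation cross := (cross_mx B0 xs us).
Notation gram := (gram_mx B0 sigma xs us).
Notation D := (Dk B0 sigma xs us).

Let affH : affine_space H := gauss_space_affine F w.
Let L2H f : H f -> f \in Lfun P 2%:E.
Proof. exact: (gauss_space_L2 gF gw). Qed.
Let gaussH f : H f -> exists m s, gaussian_rv P f m s.
Proof. exact: (gauss_space_gaussian gF gw iw iFw). Qed.

Let A_sym r r' : A r r' = A r' r.
Proof. by rewrite -{1}AT mxE. Qed.

Let B0_sym x x' c c' : B0 x x' c c' = B0 x' x c' c.
Proof. by have [B0T _] := B0_psd; rewrite -B0T mxE. Qed.

Definition obs (t : 'I_n * 'I_k) (omega : T) : R := dX omega t.1 t.2.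

Lemma obsE r i : obs (r, i) = (fun omega =>
  \sum_c underline (us i) c 0 * pt (xs i, (r, c)) omega) \+ nt (i, r).
Proof.
apply/funext => omega; have /matrixP/(_ r 0) := dXE i omega.
rewrite !mxE /obs => ->; congr (_ + _).
by apply: eq_bigr => c _; rewrite mulrC.
Qed.

Lemma gauss_space_obs t : H (obs t).
Proof.
case: t => r i; rewrite obsE; have [_ HD _] := affH; apply: HD.
  by apply: gauss_space_sum => c; exact: gauss_space_path.
exact: gauss_space_noise.
Qed.

Let pt2 t : pt t \in Lfun P 2%:E := L2H (gauss_space_path F w t).
Let nt2 t : nt t \in Lfun P 2%:E := L2H (gauss_space_noise F w t).
Let obs2 t : obs t \in Lfun P 2%:E := L2H (gauss_space_obs t).

Lemma path_cov x r c x' r' c' :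
  covariance P (pt (x, (r, c))) (pt (x', (r', c'))) = (B0 x x' c c' * A r r')%:E.
Proof. by rewrite (path_term_cov gF) tensmxE. Qed.

Lemma path_obs_cov x r c r' i :
  covariance P (pt (x, (r, c))) (obs (r', i)) = (A r r' * cross x c i)%:E.
Proof.
rewrite covarianceC obsE covarianceDl//; last first.
  by apply: Lfun2_sum => c'; exact: Lfun2Z.
rewrite (covarianceC _ (nt _)) (path_noise_cov gF gw iw iFw) adde0.
rewrite (covariance_suml _ _ _ (v := fun c' => B0 (xs i) x c' c * A r' r))//; last first.
  by move=> c'; exact: path_cov.
congr _%:E; rewrite cross_mxE mxE mulr_sumr; apply: eq_bigr => c' _.
by rewrite (B0_sym x) (A_sym r); ring.
Qed.

Lemma noise_obs_cov i r r' j :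
  covariance P (nt (i, r)) (obs (r', j)) =
  (A r r' * (if i == j then sigma ^+ 2 else 0))%:E.
Proof.
rewrite covarianceC obsE covarianceDl//; last first.
  by apply: Lfun2_sum => c'; exact: Lfun2Z.
rewrite (covariance_suml _ _ _ (v := fun=> 0))//; last first.
  by move=> c'; exact: (path_noise_cov gF gw iw iFw).
rewrite big1 ?add0e; last by move=> c _; rewrite mulr0.
rewrite (noise_term_cov gF gw iw iFw) eq_sym mxE (A_sym r).
by case: eqP => _; rewrite ?mulr0// mulrC.
Qed.

Lemma obs_cov r i r' j :
  covariance P (obs (r, i)) (obs (r', j)) = (A r r' * gram i j)%:E.
Proof.
rewrite {1}obsE covarianceDl//; last first.
  by apply: Lfun2_sum => c'; exact: Lfun2Z.
rewrite noise_obs_cov.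
rewrite (covariance_suml _ _ _ (v := fun c => A r r' * cross (xs i) c j))//; last first.
  by move=> c; exact: path_obs_cov.
rewrite -EFinD gram_mxE mulrDr; congr (_ + _)%:E.
rewrite [in RHS]mxE mulr_sumr; apply: eq_bigr => c _.
by rewrite cross_mxE [(_^T) _ _]mxE mulrCA.
Qed.

(** Row [r] is regressed on row [r] of the observations alone, although [A] may correlate the rows:
    [A r r'] is common to both covariances in the normal equations, so correlation with every row
    [r'] disappears. *)
Definition resid x r c : T -> R :=
  pt (x, (r, c)) \- (fun omega => \sum_i D x i c * obs (r, i) omega).

Lemma gauss_space_resid x r c : H (resid x r c).
Proof.
have [_ HD HZ] := affH.
rewrite (_ : resid x r c = pt (x, (r, c)) \+
    (fun omega => -1 * \sum_i D x i c * obs (r, i) omega)).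
  apply: HD; first exact: gauss_space_path.
  by apply: HZ; apply: gauss_space_sum => i; exact: gauss_space_obs.
by apply/funext => omega /=; rewrite mulN1r.
Qed.

Let resid2 x r c : resid x r c \in Lfun P 2%:E := L2H (gauss_space_resid x r c).

Let Dobs2 x r c :
  (fun omega => \sum_i D x i c * obs (r, i) omega) \in Lfun P 2%:E.
Proof. by apply: Lfun2_sum => i; exact: Lfun2Z. Qed.

Lemma resid_obs_cov x r c r' j : covariance P (resid x r c) (obs (r', j)) = 0%E.
Proof.
rewrite covarianceBl// path_obs_cov.
rewrite (covariance_suml _ _ _ (v := fun i => A r r' * gram i j))//; last first.
  by move=> i; exact: obs_cov.
rewrite -EFinB -(trDk_gram xs us B0_psd sigma_gt0 x) mxE mulr_sumr -sumrB big1//.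
by move=> i _; rewrite mxE mulrCA subrr.
Qed.

(** The second residual may be replaced by its path entry, the first being uncorrelated with the
    observations; [trDk_cross] puts the one remaining correction in the form of [Bk]. *)
Lemma resid_cov x r c x' r' c' :
  covariance P (resid x r c) (resid x' r' c') =
  (Bk B0 sigma xs us x x' c c' * A r r')%:E.
Proof.
rewrite {2}/resid covarianceBr//.
rewrite [X in (_ - X)%E]covarianceC (covariance_suml _ _ _ (v := fun=> 0))//; last first.
  by move=> i; rewrite covarianceC; exact: resid_obs_cov.
rewrite big1 ?sube0; last by move=> i _; rewrite mulr0.
rewrite covarianceBl// path_cov.
rewrite (covariance_suml _ _ _ (v := fun i => A r' r * cross x' c' i))//; last first.
  by move=> i; rewrite covarianceC; exact: path_obs_cov.
rewrite -EFinB; congr _%:E.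
have subE (M N : 'M[R]_(1 + m)) : (M - N) c c' = M c c' - N c c' by rewrite !mxE.
rewrite /Bk -/(cross x) -(trDk_cross sigma xs us B0_psd) subE mulrBl.
congr (_ - _); rewrite mxE big_distrl/=; apply: eq_bigr => i _.
by rewrite ![(_^T) _ _]mxE (A_sym r); ring.
Qed.

Lemma obs_mean r i :
  ('E_P[obs (r, i)] = ((calM M0 xs *m calU us) r i)%:E)%E.
Proof.
rewrite obsE expectationD ?Lfun21//; last first.
  by apply: Lfun2_sum => c; exact: Lfun2Z.
rewrite (noise_term_mean gw) adde0.
rewrite (expectation_lin _ _ _ (v := fun c => M0 (xs i) r c))//; last first.
  by move=> c; rewrite (path_term_mean gF) mxE mxtens_indexK.
congr _%:E; rewrite calM_calUE [RHS]mxE; apply: eq_bigr => c _.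
by rewrite mulrC.
Qed.

Lemma resid_mean x r c :
  ('E_P[resid x r c] = ((M0 x - calM M0 xs *m calU us *m D x) r c)%:E)%E.
Proof.
rewrite expectationB ?Lfun21//.
rewrite (path_term_mean gF) mxE mxtens_indexK/=.
rewrite (expectation_lin _ _ _ (v := fun i => (calM M0 xs *m calU us) r i))//; last first.
  by move=> i; exact: obs_mean.
have subE (M N : 'M[R]_(n, 1 + m)) : (M - N) r c = M r c - N r c by rewrite !mxE.
rewrite -EFinB subE; congr (_ - _)%:E.
by rewrite [RHS]mxE; apply: eq_bigr => i _; rewrite mulrC.
Qed.

Definition resid_path (omega : T) : path_space 'cV[R]_n 'M[R]_(n, 1 + m) :=
  fun x => F x omega - dX omega *m D x.

Definition update (p : 'M[R]_(n, k) * path_space 'cV[R]_n 'M[R]_(n, 1 + m)) :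
    path_space 'cV[R]_n 'M[R]_(n, 1 + m) :=
  fun x => p.2 x + p.1 *m D x.

Lemma resid_pathE omega x r c : resid_path omega x r c = resid x r c omega.
Proof.
rewrite /resid_path /resid !mxE; congr (_ - _).
by apply: eq_bigr => i _; rewrite mulrC.
Qed.

Lemma resid_path_independent : independent P resid_path dX.
Proof.
have [Hc HD HZ] := affH.
(* Both spaces are annihilators inside [H]: [HX] of the observations, [HY] of [HX]. Bilinearity of
   covariance makes them affine spaces, they are uncorrelated by construction, and [HY] contains the
   observations because these define [HX]. *)
pose HX : set (T -> R) :=
  [set f | H f /\ forall t, covariance P f (obs t) = 0%E].
pose HY : set (T -> R) :=
  [set g | H g /\ forall f, HX f -> covariance P f g = 0%E].
have sX : affine_space HX.
  split=> [c|f g [Hf f0] [Hg g0]|a f [Hf f0]]; split=> [|t].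
  - exact: Hc.
  - exact: covariance_cst_l.
  - exact: HD.
  - by rewrite covarianceDl ?f0 ?g0 ?adde0//; exact: L2H.
  - exact: HZ.
  - by rewrite covarianceZl2 ?f0 ?mule0//; exact: L2H.
have sY : affine_space HY.
  split=> [c|f g [Hf f0] [Hg g0]|a f [Hf f0]]; split=> [|h Xh].
  - exact: Hc.
  - exact: covariance_cst_r.
  - exact: HD.
  - by rewrite covarianceDr ?f0 ?g0 ?adde0//; apply: L2H => //; exact: Xh.1.
  - exact: HZ.
  - rewrite covarianceC covarianceZl2; [|exact: L2H|exact: L2H Xh.1].
    by rewrite covarianceC f0// mule0.
apply: (uncorrelated_independent (HX := HX) (HY := HY)) => //.
- by move=> f [Hf _]; exact: L2H.
- by move=> f [Hf _]; exact: L2H.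
- by move=> f g [Hf _] [Hg _]; apply: gaussH; exact: HD.
- by move=> f g Xf [_]; exact.
- apply: measurable_path => x; apply: measurable_matrix => r c.
  under eq_fun do rewrite resid_pathE.
  apply: affine_space_measurable => //; split; first exact: gauss_space_resid.
  by case=> r' j; exact: resid_obs_cov.
- apply: measurable_matrix => r i.
  apply: (affine_space_measurable sY (f := obs (r, i))).
  by split=> [|f [_]]; [exact: gauss_space_obs|exact].
Qed.

Lemma measurable_resid_path : measurable_fun setT resid_path.
Proof.
apply: measurable_path => x; apply: measurable_matrix => r c.
by under eq_fun do rewrite resid_pathE; exact: Lfun_measurable (resid2 _ _ _).
Qed.

Lemma measurable_update : measurable_fun setT update.
Proof.
apply: measurable_path => x; apply: measurable_matrix => r c.
rewrite (_ : (fun p => _) = 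
    (fun p : 'M[R]_(n, k) * path_space 'cV[R]_n 'M[R]_(n, 1 + m) =>
      p.2 x r c + \sum_i p.1 r i * D x i c)).
  apply: measurable_funD.
    exact: (measurableT_comp (measurable_entry r c)
      (measurableT_comp (measurable_eval x) measurable_snd)).
  apply: measurable_sum => i; apply: measurable_funM => //.
  exact: (measurableT_comp (measurable_entry r i) measurable_fst).
by apply/funext => p; rewrite /update !mxE.
Qed.

Lemma measurable_posterior_path y :
  measurable_fun setT (fun omega => update (y, resid_path omega)).
Proof.
apply: (measurableT_comp measurable_update).
by apply: measurable_fun_pair => //; exact: measurable_resid_path.
Qed.

Definition posterior_path y : {mfun T >-> path_space 'cV[R]_n 'M[R]_(n, 1 + m)} :=
  mfun_of (measurable_posterior_path y).

Lemma posterior_pathE y omega x r c :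
  posterior_path y omega x r c = resid x r c omega + (y *m D x) r c.
Proof. by rewrite /= /update mxE resid_pathE. Qed.

(** Laws and moments under the image measure are computed under [P], where each entry of the path is
    a residual plus a constant, hence an element of [H]. *)
Lemma posterior_gaussian y :
  gaussian_process (distribution P (posterior_path y))
    (fun x (f : path_space 'cV[R]_n 'M[R]_(n, 1 + m)) => vec (f x))
    (fun x => vec (Mk M0 B0 sigma xs us y x))
    (fun x x' => Bk B0 sigma xs us x x' *t A).
Proof.
move=> p x.
pose co (i : 'I_p * 'I_((1 + m) * n)) := mxtens_unindex i.2.
pose e (i : 'I_p * 'I_((1 + m) * n))
  (f : path_space 'cV[R]_n 'M[R]_(n, 1 + m)) : R := vec (f (x i.1)) i.2 0.
pose v i : R := (y *m D (x i.1)) (co i).2 (co i).1.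
pose g i := resid (x i.1) (co i).2 (co i).1.
have me i : measurable_fun setT (e i).
  rewrite (_ : e i = (fun f => f (x i.1) (co i).2 (co i).1)).
    exact: (measurableT_comp (measurable_entry _ _) (measurable_eval (x i.1))).
  by apply/funext => f; rewrite /e mxE.
have eE i : e i \o posterior_path y = g i \+ cst (v i).
  by apply/funext => omega; rewrite /e /= mxE -posterior_pathE.
have Hg i : H (g i \+ cst (v i)).
  have [Hc HD _] := affH; apply: HD => //; exact: gauss_space_resid.
have g2 i : g i \in Lfun P 2%:E by exact: resid2.
have [Hc HD HZ] := affH.
split=> [|i|i j].
- split=> // c.
  have Hs : H (fun omega => \sum_i c i * (g i \+ cst (v i)) omega).
    by apply: gauss_space_sum.
  have [mm [ss [_ s0 law]]] := gaussH Hs; exists mm, ss; split=> // B mB.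
  rewrite -(law _ mB) (_ : (fun omega => \sum_i c i * (g i \+ cst (v i)) omega) =
    (fun f : path_space 'cV[R]_n 'M[R]_(n, 1 + m) =>
       \sum_i c i * e i f) \o posterior_path y)//.
  apply/funext => omega /=; apply: eq_bigr => i _.
  by rewrite -[e i _]/((e i \o posterior_path y) omega) eE.
- rewrite (expectation_distribution P (posterior_path y) (me i)) eE.
  rewrite expectationD ?Lfun21 ?Lfun_cst// /g resid_mean expectation_cst -EFinD.
  congr _%:E; rewrite [RHS]mxE -/(co i) /Mk mulmxBl [in RHS]addrCA [RHS]mxE.
  by rewrite addrC.
- rewrite (covariance_distribution P _ (me i) (me j)) !eE.
  have c2 a : cst a \in Lfun P 2%:E by exact: Lfun_cst.
  rewrite covarianceDl//; last exact: Lfun2D.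
  rewrite covariance_cst_l adde0 covarianceDr// covariance_cst_r adde0.
  by rewrite /g resid_cov [in RHS]mxE.
Qed.

(** Adding the regression term back to the residual path recovers [F]; freezing [dX] at [y] in this
    identity gives [posterior_path y]. *)
Lemma posterior_conditional :
  conditional_distribution P (sample_path (fun x => F x)) dX
    (fun y => distribution P (posterior_path y)).
Proof.
have -> : sample_path (fun x => F x) =
    (fun omega => update (dX omega, mfun_of measurable_resid_path omega)).
  by apply/funext => omega; apply/funext => x; rewrite /update/= subrK.
apply: conditional_distribution_of_independent => //; first exact: measurable_update.
by move=> B C mB mC; rewrite setIC muleC; exact: resid_path_independent.
Qed.

End posterior.

Theorem proposition3 (R : realType) (n m k : nat)
    (d : measure_display) (T : measurableType d) (P : probability T R)
    (A : 'M[R]_n) (M0 : 'cV[R]_n -> 'M[R]_(n, 1 + m))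
    (B0 : 'cV[R]_n -> 'cV[R]_n -> 'M[R]_(1 + m)) (sigma : R)
    (xs : 'I_k -> 'cV[R]_n) (us : 'I_k -> 'cV[R]_m)
    (F : 'cV[R]_n -> {RV P >-> 'M[R]_(n, 1 + m)})
    (w : 'I_k -> {RV P >-> 'cV[R]_n})
    (dX : {RV P >-> 'M[R]_(n, k)}) :
  posdef_mx A ->
  psd_kernel B0 ->
  0 < sigma ->
  gaussian_process P (fun x omega => vec (F x omega))
    (fun x => vec (M0 x)) (fun x x' => B0 x x' *t A) ->
  (forall i, gaussian_vector P (w i) 0 (sigma ^+ 2 *: A)) ->
  mutually_independent P (fun i => w i) ->
  independent P
    (sample_path (fun x => F x))
    (fun omega => \matrix_(r < n, i < k) w i omega r 0) ->
  (forall i omega,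
     col i (dX omega) = F (xs i) omega *m underline (us i) + w i omega) ->
  exists kappa : 'M[R]_(n, k) ->
                 probability (path_space 'cV[R]_n 'M[R]_(n, 1 + m)) R,
    conditional_distribution P (sample_path (fun x => F x)) dX kappa /\
    forall y : 'M[R]_(n, k),
      gaussian_process (kappa y)
        (fun x (f : path_space 'cV[R]_n 'M[R]_(n, 1 + m)) => vec (f x))
        (fun x => vec (Mk M0 B0 sigma xs us y x))
        (fun x x' => Bk B0 sigma xs us x x' *t A).
Proof.
move=> [AT _] B0_psd sigma_gt0 gF gw iw iFw dXE.
exists (fun y => distribution P
  (posterior_path gF gw dXE y)).
split; first exact: posterior_conditional.
by move=> y; exact: posterior_gaussian.
Qed.
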